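(* Let $q=p^k$ for some odd prime $p$ and $k\geq 1$, and let $f\in \mathbb{F}_q[x]$ with $d:=\deg(f)\geq 2$. Suppose that $f$ is \textbf{not} of any of the following forms: (a) $f=A(x-B)^{p^e}$ for some $A,B\in \mathbb{F}_q$, $e\geq 1$; (b) $f=Ag^2$ for some $A\in\mathbb{F}_q$, $g\in\mathbb{F}_q[x]$; (c) $f=Axg^2$ for some $A\in\mathbb{F}_q$, $g\in\mathbb{F}_q[x]$; (d) $f=Ah^2+B$, where $A,B\in\mathbb{F}_q$ and $h=\sum_{i=0}^{n}a_ix^i$ satisfies $a_0=\pm\sqrt{-\frac{B}{A}}$ and $i(2i-1)Ba_i=-2(n+i-1)(n-i+1)a_{i-1}$ for $i\in\{1,2,\dots,n\}$; (e) $f=A(x-B)g^2$, where $A,B\in\mathbb{F}_q$ and $g=\sum_{i=0}^{n}a_ix^i$ satisfies $\pm a_0=\sqrt{-\frac{1}{A}}$ and $i(2i-1)Ba_i=-2(n-i+1)(n+i)a_{i-1}$ for $i=1,2,\dots,n$. Let $a\in\mathbb{F}_q$. Then the longest sequence of consecutive squares (or of consecutive non-squares) in $\mathcal{O}_f(a)$ has length $O\left(q^{\frac{2\log_2(d)+1}{2\log_2(d)+2}}\right)$, where the implied constant depends only on $d$.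
   Context: $f^n$ denotes the $n$-th iterate of $f$ under composition, with $f^0=x$. $\mathcal{O}_f(a)=\{a,f(a),f^2(a),\dots\}$ is the forward orbit of $a$. ''$n$ consecutive elements of $\mathcal{O}_f(a)$'' means elements of the form $f^i(a),f^{i+1}(a),\dots,f^{i+n-1}(a)$ for some $i\geq 0$. In (d) and (e), $n$ is a nonnegative integer and the square root denotes a square root in an algebraic closure of $\mathbb{F}_q$. *)

(* Defs.v *)
From HB Require Import structures.
From mathcomp Require Import all_boot all_order all_algebra all_field.
From mathcomp Require Import reals exp.

Set Implicit Arguments.
Unset Strict Implicit.
Unset Printing Implicit Defensive.

Import Order.TTheory GRing.Theory Num.Theory.
Local Open Scope ring_scope.

Definition alg_closure (F : finFieldType) : closedFieldType :=
  projT1 (countable_algebraic_closure F).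

Definition alg_closure_inj (F : finFieldType) : {rmorphism F -> alg_closure F} :=
  sval (projT2 (countable_algebraic_closure F)).

Section Dynamics.
Variable F : finFieldType.

Definition poly_iter (f : {poly F}) (n : nat) : {poly F} :=
  iter n (fun g => f \Po g) 'X.

Definition is_square (x : F) : bool := [exists y : F, x == y ^+ 2].

(* The orbit is a set and [n] consecutive elements of it are [n] distinct
   elements; without [uniq], a cycle contained in [P] would carry runs of
   every length. *)
Definition consecutive_run (P : pred F) (f : {poly F}) (a : F) (n : nat) : Prop :=
  exists i : nat,
    let s := [seq (poly_iter f j).[a] | j <- iota i n] in uniq s /\ all P s.

Definition form_a (p : nat) (f : {poly F}) : Prop :=
  exists (A B : F) (e : nat),
    (1 <= e)%N /\ f = A *: ('X - B%:P) ^+ (p ^ e).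

Definition form_b (f : {poly F}) : Prop :=
  exists (A : F) (g : {poly F}), f = A *: g ^+ 2.

Definition form_c (f : {poly F}) : Prop :=
  exists (A : F) (g : {poly F}), f = A *: ('X * g ^+ 2).

(* In [form_d] and [form_e] the constant coefficient is a square root taken in
   the algebraic closure, so the polynomials [h] and [g] have their
   coefficients there.  If [A = 0] then [f] is constant, so the value of
   [_ / A] is irrelevant for polynomials of degree at least 2. *)
Definition form_d (f : {poly F}) : Prop :=
  let iota := alg_closure_inj F in
  exists (A B : F) (n : nat) (a : nat -> alg_closure F),
    let h := \poly_(i < n.+1) a i in
    [/\ map_poly iota f = iota A *: h ^+ 2 + (iota B)%:P,
        a 0%N ^+ 2 = iota (- (B / A)) &
        forall i : nat, (1 <= i <= n)%N ->
          i%:R * (2 * i%:R - 1) * iota B * a i =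
          - 2 * (n%:R + i%:R - 1) * (n%:R - i%:R + 1) * a (i - 1)%N].

Definition form_e (f : {poly F}) : Prop :=
  let iota := alg_closure_inj F in
  exists (A B : F) (n : nat) (a : nat -> alg_closure F),
    let g := \poly_(i < n.+1) a i in
    [/\ map_poly iota f = iota A *: (('X - (iota B)%:P) * g ^+ 2),
        a 0%N ^+ 2 = iota (- (1 / A)) &
        forall i : nat, (1 <= i <= n)%N ->
          i%:R * (2 * i%:R - 1) * iota B * a i =
          - 2 * (n%:R - i%:R + 1) * (n%:R + i%:R) * a (i - 1)%N].

End Dynamics.

Definition log2 (R : realType) (x : R) : R := ln x / ln 2.

(* Main.v *)
(* Let w = isqrt q, and for x in F let chi be the quadratic character.  If
   iterates f^j (j < m) take only square (or only non-square) values along a run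
   of length n, then expanding sum_x prod_(j < m) (1 +- chi (f^j x)) over the
   subsets A of {0, ..., m-1} bounds (n - m) 2^m by
   O(q + 2^m max_A |sum_x chi (prod_(j in A) f^j x)|).  Stepanov's method gives
   |sum_x chi (g x)| = O(deg g * w) whenever g is not a constant times a square,
   and m = log_(2d) w balances the two terms.

   It remains to see when prod_(j in A) f^j is a constant times a square.  Over
   the algebraic closure, it makes the set Z of points that are roots of odd
   multiplicity of some f^j, j < max A, finite and closed under odd-multiplicity
   preimages by f.  Riemann-Hurwitz then forces #|Z| <= 2 unless f is a Frobenius
   power of a linear polynomial.  If Z = {0}, then f = A g^2 or f = A x g^2.  If
   Z = {0, s}, then either f = A x (x - s) g^2 and f - s = A h^2, or
   f = A (x - s) g^2 and f - s = A x h^2; in both cases g h divides f', so f' is a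
   constant multiple of g h, and the resulting second order linear differential
   equation is the coefficient recurrence of forms (d) and (e). *)

Require Import Defs.
From HB Require Import structures.
From mathcomp Require Import all_boot all_order all_algebra all_field.
From mathcomp Require Import reals exp.
From mathcomp Require Import ring lra zify.

Set Implicit Arguments.
Unset Strict Implicit.
Unset Printing Implicit Defensive.

Import Order.TTheory GRing.Theory Num.Theory.
Local Open Scope ring_scope.

(** * Taylor expansion at [X + g T] *)

Section TaylorShift.
Variable F : fieldType.
Implicit Types (g u : {poly F}) (P Q : {poly {poly F}}).

(** This is [u(X + g T)], with [T] the outer variable. Scaling the increment by [g] makes [g] divide
    its own shift, so powers of [g] factor out of the expansion. *)
Definition taylor_shift g u : {poly {poly F}} :=
  u^:P \Po ('X%:P + g%:P * 'X).

Lemma coef_taylor_shift g u i : (taylor_shift g u)`_i = u^`N(i) * g ^+ i.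
Proof.
have -> : taylor_shift g u =
    \sum_(i < size u) (u^`N(i) * g ^+ i)%:P * 'X ^+ i.
  rewrite /taylor_shift /comp_poly nderiv_taylor; last exact: mulrC.
  rewrite !size_map_polyC; apply: eq_bigr => j _.
  rewrite !nderivn_map horner_map exprMn mulrA polyCM polyC_exp.
  by congr (_ * _ * _); congr (_%:P); exact: comp_polyXr.
rewrite coef_sum; case: (ltnP i (size u)) => hi.
  rewrite (bigD1 (Ordinal hi)) //= coefCM coefXn eqxx mulr1 big1 ?addr0 // => j.
  by rewrite -val_eqE /= coefCM coefXn eq_sym => /negPf->; rewrite mulr0.
rewrite nderivn_poly0 // mul0r big1 // => j _.
rewrite coefCM coefXn [i == _]gtn_eqF ?mulr0 //.
exact: leq_trans (ltn_ord j) hi.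
Qed.

Lemma taylor_shiftM g : {morph taylor_shift g : u v / u * v}.
Proof. by move=> u v; rewrite /taylor_shift rmorphM /= comp_polyM. Qed.

Lemma taylor_shiftD g : {morph taylor_shift g : u v / u + v}.
Proof. by move=> u v; rewrite /taylor_shift rmorphD /= comp_polyD. Qed.

Lemma taylor_shift1 g : taylor_shift g 1 = 1.
Proof. by rewrite /taylor_shift rmorph1 comp_polyC. Qed.

Lemma taylor_shift0 g : taylor_shift g 0 = 0.
Proof. by rewrite /taylor_shift rmorph0 comp_poly0. Qed.

Lemma taylor_shiftX g u n : taylor_shift g (u ^+ n) = taylor_shift g u ^+ n.
Proof.
by elim: n => [|n IH]; rewrite ?taylor_shift1 // !exprS taylor_shiftM IH.
Qed.

Lemma taylor_shift_sum g (I : Type) (r : seq I) (G : I -> {poly F}) :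
  taylor_shift g (\sum_(i <- r) G i) = \sum_(i <- r) taylor_shift g (G i).
Proof.
exact: (big_morph _ (taylor_shiftD g) (taylor_shift0 g)).
Qed.

(* Evaluating the coefficients at [x] turns the shift into [u(x + g(x) T)], so
   low order vanishing of the shift is vanishing of [u] at [x]. *)
Lemma dvdp_taylor_shift g u x M :
  g.[x] != 0 -> (forall i, (i < M)%N -> ((taylor_shift g u)`_i).[x] = 0) ->
  ('X - x%:P) ^+ M %| u.
Proof.
move=> gx0 H.
have N0 i : (i < M)%N -> u^`N(i).[x] = 0.
  move=> /H; rewrite coef_taylor_shift hornerM horner_exp => /eqP.
  by rewrite mulf_eq0 expf_eq0 (negPf gx0) andbF orbF => /eqP.
have -> : u = \sum_(i < size u) (u^`N(i).[x])%:P * ('X - x%:P) ^+ i.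
  rewrite -{1}[u]comp_polyXr -{1}(subrKC x%:P 'X).
  rewrite /comp_poly nderiv_taylor ?size_map_polyC; last exact: mulrC.
  by apply: eq_bigr => j _; rewrite nderivn_map horner_map.
apply: (big_ind (fun v => ('X - x%:P) ^+ M %| v)) => [|p1 p2 d1 d2|i _]; first exact: dvdp0.
  exact: dvdp_add.
case: (ltnP i M) => hi; first by rewrite N0 // mul0r dvdp0.
by apply: dvdp_mull; apply: dvdp_exp2l.
Qed.

(** For nonzero [g], the quotient of [g(X + g T)] by [g]; its constant coefficient in [T] is 1. *)
Definition shift_unit g : {poly {poly F}} :=
  \poly_(i < size g) (if i is j.+1 then g^`N(i) * g ^+ j else 1).

Lemma shift_unitP g : taylor_shift g g = g%:P * shift_unit g.
Proof.
apply/polyP=> i; rewrite coef_taylor_shift coefCM coef_poly.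
case: ltnP => hi; last by rewrite nderivn_poly0 // mul0r mulr0.
by case: i hi => [|i] _; rewrite ?nderivn0 ?expr0 // exprS mulrCA.
Qed.

(** A Newton polygon bound with slope [D] and intercept [b]. Intercepts add under products, so
    intercept 0 is stable under powers. *)
Definition slope_bounded (D b : nat) (P : {poly {poly F}}) :=
  forall i, (size (P`_i)%R <= b + i * D + 1)%N.

Lemma slope_boundedM D b c P Q :
  slope_bounded D b P -> slope_bounded D c Q -> slope_bounded D (b + c) (P * Q).
Proof.
move=> hP hQ i; rewrite coefM; apply: (leq_trans (size_sum _ _ _)).
apply/bigmax_leqP => j _; apply: (leq_trans (size_polyMleq _ _)).
have := leq_add (hP j) (hQ (i - j)%N).
have : (j + (i - j) = i)%N by rewrite subnKC // -ltnS.
move: (size _) (size _) => s1 s2 e hs.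
rewrite -e mulnDl; lia.
Qed.

Lemma slope_boundedX D P n : slope_bounded D 0 P -> slope_bounded D 0 (P ^+ n).
Proof.
move=> hP; elim: n => [|n IH].
  by move=> i; rewrite expr0 coef1; case: eqP => _; rewrite ?size_poly1 ?size_poly0 // addn1.
by have := slope_boundedM hP IH; rewrite -exprS.
Qed.

Lemma slope_bounded_shift g u D b :
  (size g <= D.+1)%N -> (size u <= b.+1)%N -> slope_bounded D b (taylor_shift g u).
Proof.
move=> hg hu i; rewrite coef_taylor_shift.
apply: (leq_trans (size_polyMleq _ _)).
have h1 : (size u^`N(i) <= b.+1)%N.
  by rewrite (leq_trans (size_poly _ _)) // (leq_trans (leq_subr _ _)).
have := size_poly_exp_leq g i.
have : ((size g).-1 * i <= D * i)%N by rewrite leq_mul2r; lia.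
rewrite [(i * D)%N]mulnC; move: (size _) h1 (size _) => s1 h1 s2; lia.
Qed.

(** Multiplying a coefficient of positive index by [g] gives a coefficient of the shift of [g], of
    intercept [D]; removing the factor [g] of degree [D] leaves intercept 0. *)
Lemma slope_bounded_unit g D :
  size g = D.+1 -> slope_bounded D 0 (shift_unit g).
Proof.
move=> hg i; rewrite coef_poly; case: ltnP => hi; last by rewrite size_poly0.
have g0 : g != 0 by rewrite -size_poly_eq0 hg.
case: i hi => [|i] hi; first by rewrite size_poly1.
have := @slope_bounded_shift g g D D; rewrite hg => /(_ (leqnn _) (leqnn _) i.+1).
rewrite coef_taylor_shift exprSr mulrA.
have [->|h0] := eqVneq (g^`N(i.+1) * g ^+ i) 0; first by rewrite size_poly0.
rewrite size_mul // hg; move: (size _) => s1; lia.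
Qed.

End TaylorShift.

(** * Stepanov's method *)

Lemma dvdp_prod_coprime (F : fieldType) (I : eqType) (s : seq I)
    (G : I -> {poly F}) (P : {poly F}) :
  uniq s -> {in s &, forall i j, i != j -> coprimep (G i) (G j)} ->
  {in s, forall i, G i %| P} -> \prod_(i <- s) G i %| P.
Proof.
elim: s => [|i s IH] /=; first by rewrite big_nil dvd1p.
move=> /andP[his us] hc hd; rewrite big_cons Gauss_dvdp.
  rewrite hd ?mem_head //= IH // => [j k hj hk|j hj].
    by apply: hc; rewrite inE ?hj ?hk orbT.
  by apply: hd; rewrite inE hj orbT.
rewrite big_seq.
apply: (big_ind (fun v => coprimep (G i) v)) => [|u v hu hv|j hj].
- exact: coprimep1.
- by rewrite coprimepMr hu.
apply: hc; rewrite ?inE ?eqxx ?hj ?orbT //.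
by apply: contraNneq his => ->.
Qed.

(** [Q] is the field size, [h.*2] the vanishing order, [J] the number of powers of ['X^Q] and [B]
    the size bound on their coefficients. The five conditions serve independence and the pigeonhole;
    the last claim turns the resulting zero count into an excess of order [D * w] over [Q / 2]. *)
Lemma stepanov_parameters Q e D w :
  Q = e.*2.+1 -> (0 < D)%N -> (w ^ 2 <= Q)%N -> (Q < w.+1 ^ 2)%N ->
  (30 * D * w < Q)%N ->
  let h := w./2 in let J := (h + 2 * D + 2)%N in let B := (Q - D)./2 in
  [/\ (0 < e)%N, (0 < B)%N, (B.*2 + D <= Q.+1)%N, (h.*2 <= Q)%N &
      (h.*2 * (B + h.*2 * D + J) < J * B + J * B)%N] /\
  forall N, (N * h.*2 <= B + e * D + Q * J)%N -> (2 * N <= Q + 30 * D * w)%N.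
Proof.
move=> hQ D0 wQ Qw small h J B.
have hw : (h.*2 <= w <= h.*2.+1)%N by rewrite /h; lia.
have hB : (B.*2 <= Q - D <= B.*2.+1)%N by rewrite /B; lia.
have hJ : J = (h + 2 * D + 2)%N by [].
move: h J B hw hB hJ => h J B hw hB hJ.
(* Otherwise [w ^ 2 + 2 w <= 30 D w < Q], against [Q < (w + 1) ^ 2]. *)
have w30 : (30 * D <= w + 1)%N.
  rewrite leqNgt; apply/negP => hlt.
  have : ((w + 2) * w <= 30 * D * w)%N by rewrite leq_mul2r; lia.
  lia.
have h14 : (14 * D <= h)%N by lia.
have wle : (w <= w ^ 2)%N by nia.
have DQ : (D < Q)%N by have : (D * 1 <= D * w)%N; [rewrite leq_mul2l; lia | lia].
have hh : (h.*2 ^ 2 <= w ^ 2)%N by rewrite leq_sqr; lia.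
have hhB : (4 * h ^ 2 <= B.*2.+1 + D)%N by lia.
have h14h : (14 * D * h <= h ^ 2)%N by rewrite -mulnn leq_mul2r h14 orbT.
have hleh : (h <= h ^ 2)%N by nia.
have B0 : (0 < B)%N by lia.
have Dh : (D * D <= D * h)%N by rewrite leq_mul2l; lia.
have key : ((D + 1) * (4 * h ^ 2) <= (D + 1) * (B.*2.+1 + D))%N by rewrite leq_mul2l hhB orbT.
split.
  split; [lia | lia | lia | lia |].
  (* The pigeonhole inequality after subtracting [2 h B] from both sides and halving. *)
  suff : (h * (h.*2 * D + J) < (2 * D + 2) * B)%N by rewrite hJ; lia.
  have : ((h * D) <= h ^ 2 * D)%N by rewrite leq_mul2r hleh orbT.
  rewrite hJ; lia.
move=> N H.
have QD : (Q * 1 <= Q * D)%N by rewrite leq_mul2l D0 orbT.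
have BQ : (B.*2 <= Q)%N by lia.
have H2 : (4 * h * N <= 2 * h * Q + 10 * Q * D)%N.
  have : (e.*2 * D <= Q * D)%N by rewrite leq_mul2r; lia.
  rewrite hJ in H; lia.
have w3 : (w <= 3 * h)%N by lia.
have Q6 : (Q <= 6 * w * h)%N.
  have : (w * w <= w * (3 * h))%N by rewrite leq_mul2l w3 orbT.
  have : (2 * w <= w * w)%N by rewrite leq_mul2r; lia.
  lia.
have Q6D : (10 * (Q * D) <= 10 * (6 * w * h * D))%N by rewrite leq_mul2l leq_mul2r Q6 orbT.
have : (2 * h * (2 * N) <= 2 * h * (Q + 30 * D * w))%N by lia.
by rewrite leq_mul2l; case/orP => //; lia.
Qed.

Section Stepanov.
Variables (F : finFieldType) (p k : nat).
Hypotheses (p_pr : prime p) (p_odd : odd p) (cardF : #|F| = (p ^ k)%N).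
Implicit Types (g u : {poly F}).
Local Notation q := #|F|.
Local Notation e := (q.-1)./2.

Lemma exprD_card (R : comNzRingType) (x y : {poly R}) :
  p \in [pchar R] -> (x + y) ^+ q = x ^+ q + y ^+ q.
Proof.
by move=> pR; apply: exprDn_pchar; rewrite cardF pnatX pnatE // pchar_poly pR.
Qed.

Lemma pchar_card : p \in [pchar F].
Proof. exact: card_finPcharP cardF p_pr. Qed.

Lemma exprB_card (x y : {poly F}) : (x - y) ^+ q = x ^+ q - y ^+ q.
Proof. by apply/eqP; rewrite eq_sym subr_eq -exprD_card ?pchar_card // subrK. Qed.

Lemma card_half : q = e.*2.+1.
Proof.
have : odd q by rewrite cardF oddX p_odd orbT.
by case: (q) => // n /=; lia.
Qed.

(* [g ^ q = g(0)] modulo ['X^q], so the part of the relation of degree less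
   than [q] reads [r0 ^ 2 g = g(0) s0 ^ 2]. *)
Lemma frobenius_independence_head g D B (r0 s0 R S : {poly F}) :
  size g = D.+1 -> (0 < B)%N -> (B.*2 + D <= q.+1)%N -> g.[0] != 0 ->
  (forall c u, g <> c *: u ^+ 2) ->
  (size r0 <= B)%N -> (size s0 <= B)%N ->
  (r0 + 'X^q * R) + (s0 + 'X^q * S) * g ^+ e = 0 -> r0 = 0 /\ s0 = 0.
Proof.
move=> hg B_gt0 hB g0 gns hr hs H.
have g_neq0 : g != 0 by rewrite -size_poly_eq0 hg.
have H2 : (r0 + 'X^q * R) ^+ 2 * g = (s0 + 'X^q * S) ^+ 2 * g ^+ q.
  have -> : r0 + 'X^q * R = - ((s0 + 'X^q * S) * g ^+ e) by apply/eqP; rewrite -addr_eq0 H.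
  by rewrite sqrrN exprMn -exprM muln2 -mulrA -exprSr -card_half.
have [h hh] : exists h, g ^+ q = (g.[0])%:P + 'X^q * h.
  have /dvdpP[h hh] : 'X %| g - (g.[0])%:P.
    rewrite -['X]subr0 -[0 in X in X %| _]polyC0 dvdp_XsubCl rootE.
    by rewrite !hornerE subrr.
  exists (h ^+ q); rewrite [LHS](_ : _ = (g - (g.[0])%:P) ^+ q + (g.[0])%:P).
    by rewrite hh exprMn addrC mulrC.
  by rewrite exprB_card -polyC_exp expf_card subrK.
have dvdq : 'X^q %| r0 ^+ 2 * g - g.[0] *: s0 ^+ 2.
  have -> : r0 ^+ 2 * g - g.[0] *: s0 ^+ 2 =
    'X^q * (s0 ^+ 2 * h + (2 * s0 * S + 'X^q * S ^+ 2) * ((g.[0])%:P + 'X^q * h)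
         - (2 * r0 * R + 'X^q * R ^+ 2) * g).
    move: H2; rewrite hh -mul_polyC; move: ('X^q) (g.[0])%:P => X c H2.
    apply/eqP; rewrite -subr_eq0; apply/eqP.
    move/eqP: H2; rewrite -subr_eq0 => /eqP H2; rewrite -H2; ring.
  exact: dvdp_mulIl.
(* Both terms have degree at most [2 (B - 1) + D], which is below [q], so divisibility by ['X^q]
   forces equality. *)
have eq0 : r0 ^+ 2 * g = g.[0] *: s0 ^+ 2.
  apply/eqP; rewrite -subr_eq0; apply: contraTT dvdq => n0.
  apply: contra n0 => dq; move: (dq); apply: contraTT => n0.
  apply/negP => /(dvdp_leq n0); rewrite size_polyXn leqNgt => /negP; apply.
  rewrite ltnS; apply: (leq_trans (size_polyD _ _)); rewrite geq_max size_polyN.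
  apply/andP; split.
    apply: (leq_trans (size_polyMleq _ _)); rewrite hg.
    have := size_poly_exp_leq r0 2; move: (size (r0 ^+ 2)) => t; lia.
  apply: (leq_trans (size_scale_leq _ _)).
  have := size_poly_exp_leq s0 2; move: (size (s0 ^+ 2)) => t; lia.
have [r00|r0n] := eqVneq r0 0.
  split=> //; move: eq0; rewrite r00 expr0n mul0r => /esym/eqP.
  by rewrite scaler_eq0 (negPf g0) expf_eq0 => /eqP.
(* The quotient of [s0] by [r0] would exhibit [g] as a constant times a square. *)
have : r0 %| s0.
  rewrite -(@dvdp_pexp2r _ _ _ 2) // -(dvdpZr _ _ g0) -eq0; exact: dvdp_mulIl.
case/dvdpP => t st; case: (gns g.[0] t).
apply: (@mulfI _ (r0 ^+ 2)); first by rewrite expf_neq0.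
by rewrite eq0 st -scalerAr exprMn [_ * r0 ^+ 2]mulrC.
Qed.

(** Induction on [J]: the block [j = 0] vanishes by the previous lemma, and the rest is divisible by
    ['X^q]. *)
Lemma frobenius_independence g D B J (r s : 'I_J -> {poly F}) :
  size g = D.+1 -> (0 < B)%N -> (B.*2 + D <= q.+1)%N -> g.[0] != 0 ->
  (forall c u, g <> c *: u ^+ 2) ->
  (forall j, (size (r j) <= B)%N) -> (forall j, (size (s j) <= B)%N) ->
  \sum_(j < J) (r j + s j * g ^+ e) * 'X^(q * j) = 0 ->
  forall j, r j = 0 /\ s j = 0.
Proof.
move=> hg B_gt0 hB g0 gns; elim: J r s => [|J IH] r s hr hs; first by move=> _ [].
rewrite big_ord_recl muln0 expr0 mulr1.
have -> : \sum_(i < J) (r (lift ord0 i) + s (lift ord0 i) * g ^+ e) *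
            'X^(q * lift ord0 i) =
  'X^q * \sum_(i < J) (r (lift ord0 i) + s (lift ord0 i) * g ^+ e) * 'X^(q * i).
  rewrite mulr_sumr; apply: eq_bigr => i _.
  by rewrite lift0 mulnS exprD mulrCA.
move=> H.
have [r00 s00] : r ord0 = 0 /\ s ord0 = 0.
  apply: (@frobenius_independence_head g D B _ _
    (\sum_(i < J) r (lift ord0 i) * 'X^(q * i))
    (\sum_(i < J) s (lift ord0 i) * 'X^(q * i))) => //.
  rewrite -[RHS]H mulrDl addrACA -mulrA -mulrDr; congr (_ + 'X^q * _).
  rewrite mulr_suml -big_split; apply: eq_bigr => i _ /=.
  by rewrite mulrDl [_ * 'X^_ * _]mulrAC.
move: H; rewrite r00 s00 mul0r !add0r => /eqP.
rewrite mulf_eq0 expf_eq0 polyX_eq0 andbF /= => /eqP /IH IHH.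
move=> j; have [[i ->]|->] : (exists i, j = lift ord0 i) \/ j = ord0.
  by case: (unliftP ord0 j) => [i ->|->]; [left; exists i | right].
  by apply: IHH => i'; [exact: hr | exact: hs].
by split.
Qed.

(** * Stepanov's auxiliary polynomial *)

Definition auxiliary_poly g J (r s : 'I_J -> {poly F}) : {poly F} :=
  \sum_(j < J) (r j + s j * g ^+ e) * 'X^(q * j).

(** The Taylor coefficients of [auxiliary_poly] with [g ^+ e] replaced by 1 and ['X^q] by ['X], as
    is legitimate at the points being counted. Making these polynomials zero gives vanishing at all
    such points at once, and their degrees are small. *)
Definition auxiliary_coef g J (r s : 'I_J -> {poly F}) i : {poly F} :=
  \sum_(j < J) ((taylor_shift g (r j))`_i +
                (taylor_shift g (s j) * shift_unit g ^+ e)`_i) * 'X^j.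

(** The shift of ['X^n] has constant coefficient ['X^n] in [T]; the additive map of raising to the
    power [q] sends the remaining terms to multiples of [T^q]. *)
Lemma taylor_shift_expXq g n :
  exists W, taylor_shift g ('X^(q * n)) = ('X^(q * n))%:P + 'X^q * W.
Proof.
have [W hW] : exists W, taylor_shift g 'X^n = ('X^n)%:P + 'X * W.
  have := coef_taylor_shift g 'X^n 0; rewrite nderivn0 expr0 mulr1.
  elim/poly_ind: (taylor_shift g 'X^n) => [|W c _] hc.
    by exists 0; move: hc; rewrite coef0 => <-; rewrite mulr0 addr0 polyC0.
  exists W; move: hc; rewrite coefD coefMX coefC /= add0r => ->.
  by rewrite addrC mulrC.
exists (W ^+ q).
rewrite mulnC exprM taylor_shiftX hW exprD_card ?pchar_poly ?pchar_card //.
by rewrite exprMn !polyC_exp.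
Qed.

(** Below order [M <= q] the powers of ['X^q] behave as constants, and [g(x)^e = 1], [x^q = x] turn
    the Taylor coefficients into values of [auxiliary_coef]. *)
Lemma dvdp_auxiliary_poly g J M (r s : 'I_J -> {poly F}) x :
  (M <= q)%N -> (forall i, (i < M)%N -> auxiliary_coef g r s i = 0) ->
  g.[x] ^+ e = 1 -> (0 < e)%N ->
  ('X - x%:P) ^+ M %| auxiliary_poly g r s.
Proof.
move=> Mq H gx e0; apply: (@dvdp_taylor_shift _ g).
  by apply: contra_eq_neq gx => ->; rewrite expr0n gtn_eqF // eq_sym oner_eq0.
move=> i iM; rewrite /auxiliary_poly taylor_shift_sum coef_sum horner_sum.
have := congr1 (horner^~ x) (H i iM); rewrite horner0 /auxiliary_coef horner_sum.
apply: etrans; apply: eq_bigr => j _.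
rewrite taylor_shiftM taylor_shiftD taylor_shiftM taylor_shiftX shift_unitP.
have [W ->] := taylor_shift_expXq g j.
rewrite mulrDr coefD mulrCA coefXnM (leq_trans iM Mq) addr0 coefMC.
rewrite hornerM exprMn -polyC_exp mulrCA coefD coefCM hornerM !hornerD hornerM.
by rewrite !horner_exp gx mul1r hornerX exprM expf_card.
Qed.

(** The exponent [e] is absent from the bound because [shift_unit g] has intercept 0. *)
Lemma size_auxiliary_coef g D B J M (r s : 'I_J -> {poly F}) i :
  size g = D.+1 -> (0 < B)%N -> (i < M)%N ->
  (forall j, (size (r j) <= B)%N) -> (forall j, (size (s j) <= B)%N) ->
  (size (auxiliary_coef g r s i) <= B + M * D + J)%N.
Proof.
move=> hg B0 iM hr hs; apply: (leq_trans (size_sum _ _ _)).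
apply/bigmax_leqP => j _; apply: (leq_trans (size_polyMleq _ _)).
rewrite size_polyXn addnS /=.
have hB (b : {poly F}) : (size b <= B)%N -> (size b <= B.-1.+1)%N by rewrite prednK.
have hgD : (size g <= D.+1)%N by rewrite hg.
have h1 := @slope_bounded_shift _ g _ D _ hgD (hB _ (hr j)) i.
have h2 := @slope_bounded_shift _ g _ D _ hgD (hB _ (hs j)).
have h3 := slope_boundedM h2 (slope_boundedX e (slope_bounded_unit hg)) i.
have hD : (i * D <= M * D)%N by rewrite leq_mul2r (ltnW iM) orbT.
have := size_polyD (taylor_shift g (r j))`_i (taylor_shift g (s j) * shift_unit g ^+ e)`_i.
have := ltn_ord j; move: h1 h3; rewrite addn0.
move: (size _) (size _) (size _) => s1 s2 s3; lia.
Qed.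

Lemma auxiliary_coefB g J (r s r' s' : 'I_J -> {poly F}) i :
  auxiliary_coef g (fun j => r j - r' j) (fun j => s j - s' j) i =
  auxiliary_coef g r s i - auxiliary_coef g r' s' i.
Proof.
have tB u v : taylor_shift g (u - v) = taylor_shift g u - taylor_shift g v.
  by apply/eqP; rewrite eq_sym subr_eq -taylor_shiftD subrK.
rewrite -sumrB; apply: eq_bigr => j _.
by rewrite !tB mulrBl !coefB -mulrBl opprD addrACA.
Qed.

Definition row_poly J B (A : 'M[F]_(J, B)) j : {poly F} := rVpoly (row j A).

(* Pigeonhole: the coefficients of all [auxiliary_coef g r s i] with [i < M]
   take fewer values than there are pairs [(r, s)]. *)
Lemma exists_auxiliary g D B J M :
  size g = D.+1 -> (0 < B)%N ->
  (M * (B + M * D + J) < J * B + J * B)%N ->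
  exists r s : 'I_J -> {poly F},
    [/\ forall j, (size (r j) <= B)%N, forall j, (size (s j) <= B)%N,
        forall i, (i < M)%N -> auxiliary_coef g r s i = 0 &
        ~ forall j, r j = 0 /\ s j = 0].
Proof.
move=> hg B0 hcard.
pose Phi (rs : 'M[F]_(J, B) * 'M[F]_(J, B)) : 'M[F]_(M, B + M * D + J) :=
  \matrix_(i, l) (auxiliary_coef g (row_poly rs.1) (row_poly rs.2) i)`_l.
have PhiE rs i l : Phi rs i l = (auxiliary_coef g (row_poly rs.1) (row_poly rs.2) i)`_l.
  by rewrite mxE.
have /injectivePn[[r s] [[r' s'] neq eqPhi]] : ~~ injectiveb Phi.
  apply/negP => /injectiveP /leq_card; rewrite card_prod !card_mx -expnD.
  by rewrite leq_exp2l ?finRing_gt1 // leqNgt hcard.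
move: PhiE eqPhi; move: Phi => Phi PhiE eqPhi.
have srow (A : 'M_(J, B)) j : (size (row_poly A j) <= B)%N by exact: size_poly.
have sB (A A' : 'M_(J, B)) j : (size (row_poly A j - row_poly A' j)%R <= B)%N.
  apply: (leq_trans (size_polyD _ _)); rewrite geq_max size_polyN.
  by apply/andP; split; exact: srow.
(* The auxiliary coefficients are additive in the pair, so the difference of two colliding pairs is
   a nonzero solution. *)
exists (fun j => row_poly r j - row_poly r' j), (fun j => row_poly s j - row_poly s' j).
split; [by move=> j; exact: sB | by move=> j; exact: sB | |].
  move=> i iM; rewrite auxiliary_coefB; apply/eqP; rewrite subr_eq0; apply/eqP.
  have sz (A A' : 'M_(J, B)) := size_auxiliary_coef hg B0 iM (srow A) (srow A').
  apply/polyP => l; case: (ltnP l (B + M * D + J)%N) => hl.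
    have := congr1 (fun A : 'M_(_, _) => A (Ordinal iM) (Ordinal hl)) eqPhi.
    by rewrite /= PhiE (PhiE (r', s')).
  apply: etrans (esym _); first exact: (nth_default 0 (leq_trans (sz r s) hl)).
  exact: (nth_default 0 (leq_trans (sz r' s') hl)).
move=> H; case/eqP: neq; congr (_, _); apply/row_matrixP => j; apply: (can_inj rVpolyK);
  apply/eqP; rewrite -subr_eq0; apply/eqP; by have [] := H j.
Qed.

Lemma card_dvdp_exp (P : {poly F}) (A : {set F}) M :
  P != 0 -> (forall x, x \in A -> ('X - x%:P) ^+ M %| P) ->
  (#|A| * M < size P)%N.
Proof.
move=> P0 H.
have : \prod_(x <- enum A) ('X - x%:P) ^+ M %| P.
  apply: dvdp_prod_coprime; first exact: enum_uniq.
    move=> x y _ _ xy; rewrite coprimep_expl // coprimep_expr //.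
    by rewrite coprimep_XsubC root_XsubC eq_sym.
  by move=> x; rewrite mem_enum; exact: H.
move/(dvdp_leq P0); apply: leq_trans.
rewrite prodrXl; have := size_exp (\prod_(x <- enum A) ('X - x%:P)) M.
rewrite size_prod_XsubC /= -cardE => <-; rewrite prednK //.
by rewrite size_poly_gt0 expf_neq0 // monic_neq0 // monic_prod_XsubC.
Qed.

(** By Euler's criterion, the points where [g] takes a nonzero square value. *)
Definition halfpow_one g : {set F} := [set x | g.[x] ^+ e == 1].

Lemma size_auxiliary_poly g D B J (r s : 'I_J -> {poly F}) :
  size g = D.+1 -> (0 < B)%N ->
  (forall j, (size (r j) <= B)%N) -> (forall j, (size (s j) <= B)%N) ->
  (size (auxiliary_poly g r s) <= B + e * D + q * J)%N.
Proof.
move=> hg B0 hr hs; apply: (leq_trans (size_sum _ _ _)).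
apply/bigmax_leqP => j _; apply: (leq_trans (size_polyMleq _ _)).
rewrite size_polyXn addnS /=; apply: leq_add; last by rewrite leq_mul2l ltnW ?orbT.
apply: (leq_trans (size_polyD _ _)); rewrite geq_max; apply/andP; split.
  by rewrite (leq_trans (hr j)) // leq_addr.
apply: (leq_trans (size_polyMleq _ _)).
have := size_poly_exp_leq g e; rewrite hg /= [(D * _)%N]mulnC.
by have := hs j; move: (size _) (size _) (e * D)%N => s1 s2 t; lia.
Qed.

(** Independence makes the auxiliary polynomial nonzero; its zeros of order [M] at the counted
    points are weighed against its degree. *)
Lemma stepanov_count g D B J M :
  size g = D.+1 -> g.[0] != 0 -> (forall c u, g <> c *: u ^+ 2) ->
  (0 < e)%N -> (0 < B)%N -> (B.*2 + D <= q.+1)%N -> (M <= q)%N ->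
  (M * (B + M * D + J) < J * B + J * B)%N ->
  (#|halfpow_one g| * M <= B + e * D + q * J)%N.
Proof.
move=> hg g0 gns e0 B0 hB hM hc.
have [r [s [hr hs haux hn]]] := exists_auxiliary hg B0 hc.
have Psi0 : auxiliary_poly g r s != 0.
  by apply/eqP => /(frobenius_independence hg B0 hB g0 gns hr hs).
apply: leq_trans (size_auxiliary_poly hg B0 hr hs); apply: ltnW.
apply: card_dvdp_exp => // x; rewrite inE => /eqP gx.
exact: (dvdp_auxiliary_poly hM haux).
Qed.

Lemma stepanov_origin g D w :
  size g = D.+1 -> (0 < D)%N -> g.[0] != 0 -> (forall c u, g <> c *: u ^+ 2) ->
  (w ^ 2 <= q)%N -> (q < w.+1 ^ 2)%N ->
  (2 * #|halfpow_one g| <= q + 30 * D * w)%N.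
Proof.
move=> hg D0 g0 gns wq qw.
(* When [q <= 30 D w] the trivial bound by [q] suffices. *)
have [hbig|hsmall] := leqP q (30 * D * w)%N.
  have : (#|halfpow_one g| <= q)%N by exact: max_card.
  by move: hbig; move: (30 * D * w)%N (#|halfpow_one _|) (q) => *; lia.
have [[e0 B0 hB hM hc] H] := stepanov_parameters card_half D0 wq qw hsmall.
by apply: H; apply: (stepanov_count hg g0 gns e0 B0 hB hM hc).
Qed.

Lemma halfpow_one_shift g c :
  #|halfpow_one (g \Po ('X + c%:P))| = #|halfpow_one g|.
Proof.
rewrite -[RHS](card_imset _ (addIr (- c))); apply: eq_card => x.
apply/idP/imsetP => [|[y hy ->]].
  rewrite inE horner_comp !hornerE => hx; exists (x + c); rewrite ?inE ?addrK //.
by move: hy; rewrite !inE horner_comp !hornerE subrK.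
Qed.

(** Translating a counted point to the origin secures [g(0) != 0]; with no counted point there is
    nothing to prove. *)
Lemma stepanov g D w :
  size g = D.+1 -> (0 < D)%N -> (forall c u, g <> c *: u ^+ 2) ->
  (w ^ 2 <= q)%N -> (q < w.+1 ^ 2)%N ->
  (2 * #|halfpow_one g| <= q + 30 * D * w)%N.
Proof.
move=> hg D0 gns wq qw.
have [->|[c]] := set_0Vmem (halfpow_one g); first by rewrite cards0.
rewrite inE => gc; rewrite -(halfpow_one_shift g c).
have e0 : (0 < e)%N by have := finRing_gt1 F; rewrite {1}card_half; case: (e).
apply: (@stepanov_origin _ D) => //.
- by rewrite size_comp_poly2 // size_XaddC.
- rewrite horner_comp !hornerE; apply: contraTneq gc => ->.
  by rewrite expr0n gtn_eqF // eq_sym oner_eq0.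
move=> a u hu; apply: (gns a (u \Po ('X - c%:P))).
rewrite -rmorphXn /= -comp_polyZ -hu -comp_polyA comp_polyD comp_polyX comp_polyC.
by rewrite subrK comp_polyXr.
Qed.

(** * Character sums and runs *)

Definition quad_char (x : F) : int :=
  (x ^+ e == 1)%:R - ((x != 0) && (x ^+ e != 1))%:R.

Lemma card_half_gt0 : (0 < e)%N.
Proof. by have := finRing_gt1 F; rewrite {1}card_half; case: (e). Qed.

Lemma one_neq_opp1 : (1 : F) != -1.
Proof.
rewrite -subr_eq0 opprK -[1 + 1]/(2%:R) -(dvdn_pcharf pchar_card).
by rewrite dvdn_prime2 //; apply: contraTN p_odd => /eqP ->.
Qed.

Lemma halfpow_sign (x : F) : x != 0 -> x ^+ e = 1 \/ x ^+ e = -1.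
Proof.
move=> x0; apply/pred2P; rewrite /pred2 /= -eqf_sqr expr1n -exprM muln2.
apply/eqP/(mulfI x0); rewrite mulr1 -exprS -card_half; exact: expf_card.
Qed.

Lemma quad_charM : {morph quad_char : x y / x * y >-> x * y}.
Proof.
move=> x y; rewrite /quad_char mulf_eq0 exprMn.
have [->|x0] := eqVneq x 0.
  by rewrite expr0n gtn_eqF ?card_half_gt0 // mul0r eq_sym oner_eq0 /= subr0 mul0r.
have [->|y0] := eqVneq y 0.
  by rewrite expr0n gtn_eqF ?card_half_gt0 // mulr0 eq_sym oner_eq0 /= subr0 mulr0.
have N := negPf one_neq_opp1.
have [->|->] := halfpow_sign x0; have [->|->] := halfpow_sign y0;
  by rewrite ?mulr1 ?mul1r ?mulrNN ?mulr1 ?eqxx ?[-1 == 1]eq_sym ?N.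
Qed.

Lemma quad_char1 : quad_char 1 = 1.
Proof. by rewrite /quad_char expr1n eqxx andbF. Qed.

Lemma quad_char_prod (I : finType) (A : {set I}) (G : I -> F) :
  quad_char (\prod_(i in A) G i) = \prod_(i in A) quad_char (G i).
Proof. exact: (big_morph _ quad_charM quad_char1). Qed.

Lemma halfpow_square (y : F) : y != 0 -> (y ^+ 2) ^+ e = 1.
Proof.
move=> y0; rewrite -exprM mul2n; apply: (mulfI y0).
by rewrite mulr1 -exprS -card_half; exact: expf_card.
Qed.

Local Notation roots1 := [set x : F | x ^+ e == 1].
Local Notation units0 := [set y : F | y != 0].
Local Notation squares := [set y ^+ 2 | y in units0].

Lemma card_halfpow_one_le : (#|roots1| <= e)%N.
Proof.
rewrite cardE; have := @max_poly_roots _ ('X^e - 1 : {poly F}) (enum roots1).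
rewrite size_XnsubC ?card_half_gt0 // ltnS; apply.
- by rewrite -size_poly_eq0 size_XnsubC ?card_half_gt0.
- by apply/allP => x; rewrite mem_enum inE rootE !hornerE subr_eq0.
- exact: enum_uniq.
Qed.

Lemma card_squares_ge : (e <= #|squares|)%N.
Proof.
set A := units0.
have hA : #|A| = e.*2.
  have -> : A = [set~ 0] by apply/setP => y; rewrite !inE.
  by rewrite cardsC1 {1}card_half.
rewrite -leq_double -hA -sum1_card (partition_big_imset (fun y : F => y ^+ 2)) /=.
rewrite -muln2 -sum_nat_const; apply: leq_sum => z /imsetP[y hy ->].
rewrite sum1dep_card; apply: (@leq_trans #|[set y; - y]|).
  by apply: subset_leq_card; apply/subsetP => t; rewrite !inE eqf_sqr => /andP[].
by rewrite cards2; case: (_ != _).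
Qed.

(** Nonzero squares are roots of [X^e - 1], which has at most [e] roots, while squaring is at most
    two-to-one on [2 e] units. *)
Lemma halfpow_one_squares :
  roots1 = [set y ^+ 2 | y in units0].
Proof.
apply/esym/eqP; rewrite eqEcard (leq_trans card_halfpow_one_le card_squares_ge) andbT.
by apply/subsetP => x /imsetP[y]; rewrite !inE => y0 ->; rewrite halfpow_square.
Qed.

Lemma quad_char_square (x : F) : x != 0 -> is_square x -> quad_char x = 1.
Proof.
move=> x0 /existsP[y /eqP xy]; rewrite /quad_char xy halfpow_square ?eqxx ?andbF //.
by apply: contraNneq x0 => y0; rewrite xy y0 expr0n.
Qed.

Lemma quad_char_nonsquare (x : F) : ~~ is_square x -> quad_char x = -1.
Proof.
move=> nx; have x0 : x != 0.
  by apply: contraNneq nx => ->; apply/existsP; exists 0; rewrite expr0n.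
rewrite /quad_char x0; have -> : (x ^+ e == 1) = false; last by [].
apply: contraNF nx => hx.
have : x \in roots1 by rewrite inE.
by rewrite halfpow_one_squares => /imsetP[y _ ->]; apply/existsP; exists y.
Qed.

Lemma exists_nonresidue : exists2 nu : F, nu != 0 & nu ^+ e = -1.
Proof.
have /subsetPn[nu] : ~~ (units0 \subset roots1).
  apply/negP => /subset_leq_card; rewrite leqNgt => /negP; apply.
  apply: leq_ltn_trans card_halfpow_one_le _.
  have -> : units0 = [set~ 0] by apply/setP => y; rewrite !inE.
  by rewrite cardsC1 {2}card_half -addnn -[X in (X < _)%N]addn0 ltn_add2l card_half_gt0.
rewrite !inE => nu0 hnu; exists nu => //.
by have [h|//] := halfpow_sign nu0; rewrite h eqxx in hnu.
Qed.

Definition char_sum g : int := \sum_(x : F) quad_char g.[x].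

Lemma quad_charE (x : F) : quad_char x = 2 * (x ^+ e == 1)%:R - 1 + (x == 0)%:R.
Proof.
rewrite /quad_char; have [->|x0] := eqVneq x 0.
  by rewrite expr0n gtn_eqF ?card_half_gt0 // eq_sym oner_eq0 /=.
by case: (_ == 1).
Qed.

(** The sum is twice the count of [halfpow_one g], minus [q], plus the number of roots of [g]. Those
    roots, at most [D], raise Stepanov's constant 30 to 31. *)
Lemma char_sum_le g D w :
  g != 0 -> (size g <= D.+1)%N -> (forall c u, g <> c *: u ^+ 2) ->
  (w ^ 2 <= q)%N -> (q < w.+1 ^ 2)%N ->
  char_sum g <= (31 * D * w)%N%:Z.
Proof.
move=> g0 gD gns wq qw.
have [D' hD'] : exists D', size g = D'.+1 by exists (size g).-1; rewrite prednK ?size_poly_gt0.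
have D'0 : (0 < D')%N.
  rewrite lt0n; apply/eqP => D0; move: hD'; rewrite D0 => /eqP/size_poly1P[c _ gc].
  by apply: (gns c 1); rewrite expr1n alg_polyC.
have DD : (D' <= D)%N by rewrite -ltnS -hD'.
have := stepanov hD' D'0 gns wq qw.
have hZ : (#|[set x | root g x]| <= D')%N.
  have := @max_poly_roots _ g (enum [set x | root g x]); rewrite -cardE hD' ltnS; apply=> //.
    by apply/allP => x; rewrite mem_enum inE.
  exact: enum_uniq.
have sumP (P : pred F) : \sum_(x : F) (P x)%:R = (#|[set x | P x]|)%:R :> int.
  rewrite -sum1_card natr_sum [RHS]big_mkcond; apply: eq_bigr => x _.
  by rewrite inE; case: (P x).
have -> : char_sum g = 2 * #|halfpow_one g|%:Z - q%:Z + #|[set x | root g x]|%:Z.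
  rewrite /char_sum (eq_bigr _ (fun x _ => quad_charE _)) !big_split /=.
  by rewrite -mulr_sumr !sumP sumr_const mulNrn !natz.
have w0 : (0 < w)%N.
  rewrite lt0n; apply: contraTneq qw => ->; rewrite -leqNgt; exact: ltnW (finRing_gt1 F).
move: hZ; move: (#|_|) (#|_|) (q) => z n Q hZ hn.
have : (D' * 1 <= D * w)%N by exact: leq_mul.
have : (D' * w <= D * w)%N by rewrite leq_mul2r DD orbT.
lia.
Qed.

(** Stepanov's method bounds the sum from above only; multiplying [g] by a nonresidue flips the sign
    and gives the lower bound. *)
Lemma char_sum_abs_le g D w (b : bool) :
  g != 0 -> (size g <= D.+1)%N -> (forall c u, g <> c *: u ^+ 2) ->
  (w ^ 2 <= q)%N -> (q < w.+1 ^ 2)%N ->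
  (-1) ^+ b * char_sum g <= (31 * D * w)%N%:Z.
Proof.
move=> g0 gD gns wq qw; case: b; last by rewrite expr0 mul1r; exact: char_sum_le.
have [nu nu0 hnu] := exists_nonresidue.
have -> : (-1) ^+ true * char_sum g = char_sum (nu *: g).
  rewrite expr1 mulr_sumr; apply: eq_bigr => x _; rewrite hornerZ quad_charM.
  by rewrite {2}/quad_char hnu nu0 eq_sym (negPf one_neq_opp1).
apply: char_sum_le => //; rewrite ?scaler_eq0 ?(negPf nu0) ?size_scale //.
move=> c u hu; apply: (gns (nu^-1 * c) u).
by rewrite -scalerA -hu scalerA mulVf // scale1r.
Qed.

(** * Products of iterates and the length of a run *)

Lemma poly_iterD (f : {poly F}) m n :
  poly_iter f (m + n) = poly_iter f m \Po poly_iter f n.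
Proof.
elim: m => [|m IH]; first by rewrite add0n /poly_iter /= comp_polyX.
by rewrite addSn /poly_iter !iterS -!/(poly_iter f _) IH comp_polyA.
Qed.

Lemma size_poly_iter (f : {poly F}) d n :
  size f = d.+1 -> (0 < d)%N -> size (poly_iter f n) = (d ^ n).+1.
Proof.
move=> hf d0; elim: n => [|n IH]; first by rewrite /poly_iter /= size_polyX.
rewrite /poly_iter iterS -/(poly_iter f n).
have /esym := size_comp_poly f (poly_iter f n); rewrite hf IH /= -expnS => h.
have : (0 < d ^ n.+1)%N by rewrite expn_gt0 d0.
by rewrite h; case: (size _) => // s _ /=.
Qed.

Lemma sum_expn_le d m : (2 <= d)%N -> (\sum_(j < m) d ^ j <= d ^ m)%N.
Proof.
move=> d2; suff : (\sum_(j < m) d ^ j < d ^ m)%N by exact: ltnW.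
elim: m => [|m IH]; first by rewrite big_ord0.
rewrite big_ord_recr /= expnS; apply: (@leq_trans (2 * d ^ m)%N).
  by rewrite mul2n -addnn ltn_add2r.
by rewrite leq_mul2r d2 orbT.
Qed.

Definition iter_prod (f : {poly F}) m (A : {set 'I_m}) : {poly F} :=
  \prod_(j in A) poly_iter f j.

Lemma iter_prod_neq0 (f : {poly F}) d m (A : {set 'I_m}) :
  size f = d.+1 -> (0 < d)%N -> iter_prod f A != 0.
Proof.
by move=> hf d0; apply/prodf_neq0 => j _; rewrite -size_poly_eq0 (size_poly_iter _ hf).
Qed.

Lemma size_iter_prod (f : {poly F}) d m (A : {set 'I_m}) :
  size f = d.+1 -> (2 <= d)%N -> (size (iter_prod f A) <= (d ^ m).+1)%N.
Proof.
move=> hf d2; have d0 : (0 < d)%N by exact: ltnW.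
rewrite size_prod => [|j _]; last by rewrite -size_poly_eq0 (size_poly_iter _ hf).
rewrite (eq_bigr (fun j : 'I_m => d ^ j + 1)%N) => [|j _]; last first.
  by rewrite (size_poly_iter _ hf) // addn1.
rewrite big_split /= sum1_card subSn ?leq_addl // addnK ltnS.
apply: leq_trans (sum_expn_le m d2).
by rewrite big_mkcond; apply: leq_sum => j _; case: ifP.
Qed.

Lemma sum_prod_char (f : {poly F}) m (b : bool) :
  \sum_(x : F) \prod_(j < m) (1 + (-1) ^+ b * quad_char (poly_iter f j).[x]) =
  \sum_(A : {set 'I_m}) ((-1) ^+ b) ^+ #|A| * char_sum (iter_prod f A).
Proof.
rewrite /char_sum (eq_bigr (fun x => \sum_(A : {set 'I_m})
   ((-1) ^+ b) ^+ #|A| * quad_char (iter_prod f A).[x])) => [|x _].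
  by rewrite exchange_big; apply: eq_bigr => A _; rewrite mulr_sumr.
rewrite (eq_bigr (fun j : 'I_m => (-1) ^+ b * quad_char (poly_iter f j).[x] + 1)) => [|j _]; last exact: addrC.
rewrite bigA_distr; apply: eq_bigr => A _.
rewrite horner_prod quad_char_prod -prodr_const -big_split /= [RHS]big_mkcond.
by [].
Qed.

Lemma sum_prod_char_le (f : {poly F}) d m w (b : bool) :
  size f = d.+1 -> (2 <= d)%N ->
  (forall A : {set 'I_m}, A != set0 -> forall c u, iter_prod f A <> c *: u ^+ 2) ->
  (w ^ 2 <= q)%N -> (q < w.+1 ^ 2)%N ->
  \sum_(x : F) \prod_(j < m) (1 + (-1) ^+ b * quad_char (poly_iter f j).[x]) <=
  (q + 2 ^ m * (31 * d ^ m * w))%N%:Z.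
Proof.
(* The empty subset contributes exactly [q]; each other subset is bounded by Stepanov's method. *)
move=> hf d2 hns wq qw; rewrite sum_prod_char (bigD1 set0) //= PoszD.
apply: lerD.
  rewrite cards0 expr0 mul1r /char_sum /iter_prod big_set0.
  by rewrite (eq_bigr (fun=> 1)) ?sumr_const ?natz // => x _; rewrite hornerC quad_char1.
apply: (@le_trans _ _ (\sum_(A : {set 'I_m}) (31 * d ^ m * w)%N%:Z)); last first.
  rewrite sumr_const -mulr_natl natz -PoszM.
  by rewrite -(cardsT {set 'I_m}) -powersetT card_powerset cardsT card_ord.
rewrite big_mkcond /=; apply: ler_sum => A _; case: ifP => // A0.
rewrite -exprM -signr_odd.
apply: char_sum_abs_le => //; first by apply: (iter_prod_neq0 _ hf); exact: ltnW.
  exact: size_iter_prod.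
exact: hns.
Qed.

Lemma prod_char_ge0 (f : {poly F}) m (b : bool) x :
  0 <= \prod_(j < m) (1 + (-1) ^+ b * quad_char (poly_iter f j).[x]).
Proof.
apply: prodr_ge0 => j _; rewrite /quad_char.
by case: b; case: (_ == 1); case: (_ != 0).
Qed.

(** Each of the [n - m] starting points of a window of length [m] contributes at least [2 ^ (m - 1)]
    to the sum, and all other terms are nonnegative. Hence the factor 2 on the right. *)
Lemma run_bound (f : {poly F}) a d m w n (b : bool) :
  size f = d.+1 -> (2 <= d)%N ->
  (forall A : {set 'I_m}, A != set0 -> forall c u, iter_prod f A <> c *: u ^+ 2) ->
  (w ^ 2 <= q)%N -> (q < w.+1 ^ 2)%N ->
  consecutive_run (fun x => is_square x (+) b) f a n ->
  ((n - m) * 2 ^ m <= 2 * (q + 2 ^ m * (31 * d ^ m * w)))%N.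
Proof.
move=> hf d2 hns wq qw [i []]; set s := [seq _ | _ <- _] => us /allP hs.
pose x t := (poly_iter f (i + t)).[a].
have nths t : (t < n)%N -> nth 0 s t = x t.
  by move=> tn; rewrite (nth_map 0%N) ?size_iota // nth_iota.
have x_inj t t' : (t < n)%N -> (t' < n)%N -> x t = x t' -> t = t'.
  move=> tn tn'; rewrite -!nths // => /eqP.
  by rewrite nth_uniq ?size_map ?size_iota // => /eqP.
have xs t : (t < n)%N -> is_square (x t) (+) b.
  by move=> tn; apply: hs; rewrite -nths // mem_nth // size_map size_iota.
have iterx t j : (poly_iter f j).[x t] = x (t + j)%N.
  by rewrite /x -horner_comp -poly_iterD addnC addnA.
have prodx t : (t < n - m)%N -> 2 ^+ m <=
    2 * \prod_(j < m) (1 + (-1) ^+ b * quad_char (poly_iter f j).[x t]) :> int.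
  move=> tm.
  have tmn j : (j < m)%N -> (t + j < n)%N by lia.
  have val j : (j < m)%N -> (x (t + j)%N != 0) -> 1 + (-1) ^+ b * quad_char (x (t + j)%N) = 2.
    move=> jm n0; have /xs := tmn j jm.
    case: (b); rewrite /= ?addbT ?addbF => h; first by rewrite quad_char_nonsquare.
    by rewrite quad_char_square.
  (* Elements of the run are distinct, so zero occurs at most once in the window; it makes one
     factor 1, and all others equal 2. *)
  have [/existsP[j0 /eqP h0]|/existsPn hn0] := boolP [exists j : 'I_m, x (t + j)%N == 0].
    rewrite (bigD1 j0) //= iterx h0.
    have -> : quad_char 0 = 0.
      by rewrite /quad_char eqxx expr0n gtn_eqF ?card_half_gt0 // eq_sym oner_eq0.
    rewrite mulr0 addr0 mul1r (eq_bigr (fun=> 2)) => [|j jj0].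
      by rewrite prodr_const cardC1 card_ord -exprS prednK // (leq_trans _ (ltn_ord j0)).
    rewrite iterx val //; apply: contraNneq jj0 => hj; apply/eqP/val_inj/(@addnI t).
    by rewrite (x_inj _ _ (tmn _ (ltn_ord j)) (tmn _ (ltn_ord j0))) // hj h0.
  rewrite (eq_bigr (fun=> 2)) => [|j _]; last by rewrite iterx val.
  by rewrite prodr_const card_ord -exprS ler_eXn2l.
have := sum_prod_char_le b hf d2 hns wq qw.
set S := \sum_(_ : F) _ => hS.
have : ((n - m) * 2 ^ m)%N%:Z <= 2 * S.
  have -> : ((n - m) * 2 ^ m)%N%:Z = \sum_(t < n - m) 2 ^+ m.
    by rewrite sumr_const card_ord -natz natrM natrX mulr_natl.
  pose X := [set x t | t : 'I_(n - m)].
  apply: (@le_trans _ _ (2 * \sum_(y in X)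
     \prod_(j < m) (1 + (-1) ^+ b * quad_char (poly_iter f j).[y]))).
    rewrite big_imset /=; last first.
      move=> t t' _ _ /x_inj h; apply/val_inj/h; exact: leq_trans (ltn_ord _) (leq_subr _ _).
    by rewrite mulr_sumr; apply: ler_sum => t _; exact: prodx.
  rewrite ler_pM2l // /S [leRHS](bigID (mem X)) /= lerDl.
  by apply: sumr_ge0 => y _; exact: prod_char_ge0.
move=> h; rewrite -lez_nat; apply: (le_trans h).
by rewrite PoszM ler_pM2l.
Qed.

End Stepanov.

(** * Roots of odd multiplicity *)

Lemma dvdp_sqr_deriv (K : fieldType) (P Q : {poly K}) : Q ^+ 2 %| P -> Q %| P^`().
Proof.
case/dvdpP => W ->; rewrite derivM expr2 derivM.
have -> : W^`() * (Q * Q) + W * (Q^`() * Q + Q * Q^`()) =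
          (W^`() * Q + W * Q^`() + W * Q^`()) * Q by ring.
exact: dvdp_mulIr.
Qed.

Section OddMultiplicity.
Variable K : closedFieldType.
Implicit Types (P Q f : {poly K}) (r z : K).

Definition root_seq P : seq K := sval (closed_field_poly_normal P).

Lemma root_seqP P : P = lead_coef P *: \prod_(r <- root_seq P) ('X - r%:P).
Proof. exact: (svalP (closed_field_poly_normal P)). Qed.

Definition odd_roots P : seq K :=
  [seq r <- undup (root_seq P) | odd (mup r P)].

Definition sqrt_part P : {poly K} :=
  \prod_(r <- undup (root_seq P)) ('X - r%:P) ^+ (mup r P)./2.

Lemma mup_root_seq P r : P != 0 -> mup r P = count_mem r (root_seq P).
Proof.
move=> P0; rewrite {1}[P]root_seqP -mul_polyC mupMr; last first.
  by rewrite rootC lead_coef_eq0.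
exact: mu_prod_XsubC.
Qed.

Lemma odd_rootsP P r : P != 0 -> (r \in odd_roots P) = odd (mup r P).
Proof.
move=> P0; rewrite mem_filter mem_undup; case: (boolP (odd _)) => //= h.
by rewrite -has_pred1 has_count -mup_root_seq // odd_gt0.
Qed.

Lemma odd_roots_uniq P : uniq (odd_roots P).
Proof. exact: filter_uniq (undup_uniq _). Qed.

Lemma sqrt_part_monic P : sqrt_part P \is monic.
Proof.
by apply: monic_prod => r _; apply: monic_exp; exact: monicXsubC.
Qed.

Lemma odd_part_decomp P : P != 0 ->
  P = lead_coef P *: (\prod_(r <- odd_roots P) ('X - r%:P) * sqrt_part P ^+ 2).
Proof.
move=> P0; rewrite {1}[P]root_seqP; congr (_ *: _).
rewrite -big_undup_iterop_count /= big_filter [X in _ = X * _]big_mkcond /=.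
rewrite /sqrt_part -prodrXl -big_split /=; apply: eq_bigr => r _.
rewrite -mup_root_seq // -[iterop _ _ _ _]/(('X - r%:P) ^+ _).
rewrite -{1}[mup r P]odd_double_half exprD -exprM muln2.
by case: (odd _); rewrite ?expr1 ?expr0.
Qed.

Lemma size_odd_part_decomp P : P != 0 ->
  (size P).-1 = (size (odd_roots P) + (size (sqrt_part P)).-1.*2)%N.
Proof.
move=> P0; rewrite {1}[P]odd_part_decomp // size_scale ?lead_coef_eq0 //.
rewrite size_monicM ?monic_prod_XsubC ?expf_neq0 ?monic_neq0 ?sqrt_part_monic //.
rewrite size_prod_XsubC addSn /= -muln2 -size_exp.
have : (0 < size (sqrt_part P ^+ 2)%R)%N.
  by rewrite size_poly_gt0 expf_neq0 ?monic_neq0 ?sqrt_part_monic.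
by case: (size _) => // n _; rewrite addnS.
Qed.

Lemma mupX r P n : P != 0 -> mup r (P ^+ n) = (n * mup r P)%N.
Proof.
move=> P0; elim: n => [|n IH]; first by rewrite expr0 mupNroot // root1.
by rewrite exprS mupM ?expf_neq0 // IH mulSn.
Qed.

(** The second factor is the ramification index of [f] at [r]. Once the full power of ['X -
    f.[r]%:P] is split off from [P], the cofactor stays nonzero at [r] after composition. *)
Lemma mup_comp P f r : P != 0 -> (1 < size f)%N ->
  mup r (P \Po f) = (mup f.[r] P * mup r (f - f.[r]%:P))%N.
Proof.
move=> P0 f1; have [m [Q]] := multiplicity_XsubC P f.[r].
rewrite P0 /= => rQ ->.
have fr0 : f - f.[r]%:P != 0.
  by apply: contraTneq f1 => /subr0_eq ->; rewrite -leqNgt size_polyC leq_b1.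
rewrite comp_polyM mupMr; last by rewrite /root horner_comp.
rewrite mupMr // mup_XsubCX eqxx rmorphXn /= comp_polyB comp_polyX comp_polyC.
exact: mupX.
Qed.

Lemma coprimep_subC P a b : a != b -> coprimep (P - a%:P) (P - b%:P).
Proof.
move=> ab; have -> : P - b%:P = 1 * (P - a%:P) + (a - b)%:P.
  by rewrite mul1r polyCB addrA subrK.
rewrite coprimep_addl_mul coprimep_sym; apply/coprimepP => D hD _.
have := dvdp_leq _ hD; rewrite polyC_eq0 subr_eq0 ab => /(_ isT).
rewrite size_polyC subr_eq0 ab => h1; rewrite -size_poly_eq1.
have D0 : D != 0.
  by apply: contraTneq hD => ->; rewrite dvd0p polyC_eq0 subr_eq0.
by rewrite eqn_leq h1 size_poly_gt0.
Qed.

Definition comp_iter f n : {poly K} := iter n (fun g => f \Po g) 'X.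

Lemma comp_iterSr f n : comp_iter f n.+1 = comp_iter f n \Po f.
Proof.
elim: n => [|n IH]; first by rewrite /comp_iter /= comp_polyX comp_polyXr.
by rewrite -[comp_iter f n.+2]/(f \Po comp_iter f n.+1) {1}IH comp_polyA.
Qed.

Lemma size_comp_iter_gt1 f n : (1 < size f)%N -> (1 < size (comp_iter f n))%N.
Proof.
move=> f1; elim: n => [|n IH]; first by rewrite size_polyX.
have := size_comp_poly (comp_iter f n) f; rewrite -comp_iterSr.
have : (0 < (size (comp_iter f n)).-1 * (size f).-1)%N by rewrite muln_gt0 -!subn1 !subn_gt0 IH f1.
by case: (size (comp_iter f n.+1)) => [|[|s]] //= h1 h2; rewrite -h2 in h1.
Qed.

(* If the product of the iterates [f^j], [j \in A], is a constant times a
   square, then each odd root of the top iterate is an odd root of a lower one,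
   so the odd roots of the lower iterates are closed under odd preimages. *)
Lemma exists_closed_odd_set f m (A : {set 'I_m}) c u :
  (1 < size f)%N -> A != set0 -> \prod_(j in A) comp_iter f j = c *: u ^+ 2 ->
  exists Z : seq K, [/\ uniq Z, 0 \in Z &
    forall r, odd (mup r (f - f.[r]%:P)) -> f.[r] \in Z -> r \in Z].
Proof.
move=> f1 /set0Pn[j0 j0A] hprod.
have f0 j : comp_iter f j != 0 by rewrite -size_poly_gt0 ltnW ?size_comp_iter_gt1.
have prod0 : \prod_(j in A) comp_iter f j != 0 by apply/prodf_neq0 => j _.
have even_mup r : ~~ odd (\sum_(j in A) mup r (comp_iter f j)).
  have -> : (\sum_(j in A) mup r (comp_iter f j) = mup r (\prod_(j in A) comp_iter f j))%N.
    pose T (n : nat) (P : {poly K}) := P != 0 /\ n = mup r P.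
    suff [] : T (\sum_(j in A) mup r (comp_iter f j))%N (\prod_(j in A) comp_iter f j) by [].
    apply: (big_ind2 T) => [|n1 P1 n2 P2 [P10 ->] [P20 ->]|//].
      by split; rewrite ?oner_neq0 // mupNroot ?root1.
    by split; rewrite ?mulf_neq0 // mupM.
  have [c0 u0] : c != 0 /\ u != 0.
    apply/andP; rewrite -negb_or; apply: contraNN prod0 => /orP[]/eqP h.
      by rewrite hprod h scale0r.
    by rewrite hprod h expr0n scaler0.
  rewrite hprod -mul_polyC mupMr ?rootC // mupX // mul2n odd_double //.
have [J JA maxJ] := @arg_maxnP _ j0 (mem A) (fun j : 'I_m => nat_of_ord j) j0A.
have lower r : odd (mup r (comp_iter f J)) ->
    exists2 j : nat, (j < J)%N & odd (mup r (comp_iter f j)).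
  (* The total multiplicity is even, so a second index of odd multiplicity exists, below [J] by
     maximality. *)
  move=> oJ; have := even_mup r; rewrite (bigD1 J) //= oddD oJ /= negbK => h.
  have /existsP[j /andP[/andP[jA jJ] oj]] :
      [exists j : 'I_m, (j \in A) && (j != J) && odd (mup r (comp_iter f j))].
    apply: contraTT h => /existsPn hn.
    apply: (big_ind (fun n => ~~ odd n)) => // [n1 n2 h1 h2|j hj].
      by rewrite oddD (negPf h1) (negPf h2).
    by have := hn j; rewrite hj.
  by exists j => //; rewrite ltn_neqAle (maxJ j jA : (j <= J)%N) andbT.
exists (undup (flatten [seq odd_roots (comp_iter f j) | j <- iota 0 J])).
set Z := undup _.
have ZP r : reflect (exists2 j : nat, (j < J)%N & odd (mup r (comp_iter f j))) (r \in Z).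
  rewrite mem_undup; apply: (iffP flatten_mapP) => -[j].
    by rewrite mem_iota odd_rootsP // => jJ; exists j.
  by move=> jJ oj; exists j; rewrite ?mem_iota // odd_rootsP.
have mup0 : mup 0 (comp_iter f 0) = 1%N.
  have -> : comp_iter f 0 = ('X - 0%:P) ^+ 1 by rewrite polyC0 subr0 expr1.
  by rewrite mup_XsubCX eqxx.
split; first exact: undup_uniq.
  (* The zeroth iterate is ['X], with odd root 0. When [J = 0], the descent [lower] applies to ['X]
     itself. *)
  apply/ZP; have [J0|] := posnP J; last by move=> J0; exists 0%N; rewrite // mup0.
  by apply: lower; rewrite J0 mup0.
move=> r or /ZP[j jJ oj]; apply/ZP.
have oS : odd (mup r (comp_iter f j.+1)).
  by rewrite comp_iterSr mup_comp // oddM oj or.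
move: jJ; rewrite leq_eqVlt => /orP[/eqP jJ|jJ]; last by exists j.+1.
by apply: lower; rewrite -jJ.
Qed.

Lemma size_prod_monic (I : Type) (s : seq I) (G : I -> {poly K}) :
  (forall i, G i \is monic) ->
  (size (\prod_(i <- s) G i)).-1 = (\sum_(i <- s) (size (G i)).-1)%N.
Proof.
move=> hG; elim: s => [|i s IH]; first by rewrite !big_nil size_poly1.
rewrite !big_cons size_monicM ?monic_neq0 ?monic_prod // -IH.
have : (0 < size (G i))%N by rewrite size_poly_gt0 monic_neq0.
have : (0 < size (\prod_(j <- s) G j)%R)%N by rewrite size_poly_gt0 monic_neq0 ?monic_prod.
by move: (size _) (size _) => a b; lia.
Qed.

(* Riemann-Hurwitz: writing [h - zt z = c_z D_z G_z ^ 2] with [D_z] squarefree,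
   [\prod_z G_z] divides [h^`()] and the [D_z] have disjoint root sets in [Z]. *)
Lemma size_closed_odd_set f h (zt : K -> K) N (Z : seq K) :
  odd N -> (forall z, f - z%:P = (h - (zt z)%:P) ^+ N) ->
  h^`() != 0 -> (2 < size h)%N -> uniq Z ->
  (forall r, odd (mup r (f - f.[r]%:P)) -> f.[r] \in Z -> r \in Z) ->
  (size Z <= 2)%N.
Proof.
move=> oN hf h'0 h2 uZ closedZ.
pose P z := h - (zt z)%:P.
have zt_inj : injective zt.
  move=> z z' e; apply/(@polyC_inj K)/oppr_inj/(addrI f).
  by rewrite !hf e.
have sP z : size (P z) = size h.
  by rewrite size_polyDl // size_polyN (leq_ltn_trans (size_polyC_leq1 _)) // ltnW.
have P0 z : P z != 0 by rewrite -size_poly_gt0 sP (leq_trans _ h2).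
have coP z z' : z != z' -> coprimep (P z) (P z').
  by move=> zz'; apply: coprimep_subC; rewrite (inj_eq zt_inj).
(* As [N] is odd, [P z] and its power [f - z%:P] have the same odd roots. *)
have oddZ z r : z \in Z -> r \in odd_roots (P z) -> r \in Z.
  move=> zZ; rewrite odd_rootsP // => or.
  have fr : f.[r] = z.
    have : root (P z) r by apply: contraTT or => /mupNroot ->.
    move=> /rootP Pr; apply/eqP; rewrite -subr_eq0 -[z in _ - z](hornerC _ r).
    by rewrite -hornerN -hornerD hf horner_exp Pr expr0n; case: (N) oN.
  by apply: closedZ; rewrite fr // hf (mupX _ _ (P0 z)) oddM oN or.
have decP z := odd_part_decomp (P0 z).
have sqP z : sqrt_part (P z) ^+ 2 %| P z.
  by rewrite [X in _ %| X]decP dvdpZr ?lead_coef_eq0 // dvdp_mulIr.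
have odP z : \prod_(r <- odd_roots (P z)) ('X - r%:P) %| P z.
  by rewrite [X in _ %| X]decP dvdpZr ?lead_coef_eq0 // dvdp_mulIl.
have hG : (\sum_(z <- Z) (size (sqrt_part (P z))).-1 < (size h).-1)%N.
  rewrite -size_prod_monic => [|z]; last exact: sqrt_part_monic.
  have : \prod_(z <- Z) sqrt_part (P z) %| h^`().
    apply: dvdp_prod_coprime => // [z z' _ _ zz'|z _].
      apply: (coprimep_dvdr (dvdp_trans _ (sqP z))); first exact: dvdp_exp.
      by apply: (coprimep_dvdl (dvdp_trans _ (sqP z'))); [exact: dvdp_exp | exact: coP].
    have -> : h^`() = (P z)^`() by rewrite derivB derivC subr0.
    exact: dvdp_sqr_deriv.
  move/(dvdp_leq h'0) => le1.
  have := lt_size_deriv (_ : h != 0); rewrite -size_poly_gt0 (leq_trans _ h2) // => /(_ isT).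
  move: le1 h2; have : (0 < size (\prod_(z <- Z) sqrt_part (P z))%R)%N.
    by rewrite size_poly_gt0 monic_neq0 // monic_prod // => z _; exact: sqrt_part_monic.
  move: (size _) (size _) (size _) => a b c; lia.
have hD : (\sum_(z <- Z) size (odd_roots (P z)) <= size Z)%N.
  rewrite (eq_bigr (fun z => (size (\prod_(r <- odd_roots (P z)) ('X - r%:P))).-1)); last first.
    by move=> z _; rewrite size_prod_XsubC.
  rewrite -size_prod_monic => [|z]; last exact: monic_prod_XsubC.
  have : \prod_(z <- Z) \prod_(r <- odd_roots (P z)) ('X - r%:P) %| \prod_(r <- Z) ('X - r%:P).
    apply: dvdp_prod_coprime => // [z z' _ _ zz'|z zZ].
      apply: (coprimep_dvdr (odP z)); apply: (coprimep_dvdl (odP z')); exact: coP.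
    apply: uniq_roots_dvdp; last by rewrite uniq_rootsE odd_roots_uniq.
    by apply/allP => r /(oddZ _ _ zZ); rewrite root_prod_XsubC.
  move/dvdp_leq => /(_ (monic_neq0 (monic_prod_XsubC _ _ _))).
  by rewrite size_prod_XsubC; case: (size _).
(* With [n] the degree of [h], the count reads [#|Z| n <= #|Z| + 2 (n - 1)], and [n >= 2] gives
   [#|Z| <= 2]. *)
have : (\sum_(z <- Z) (size h).-1 = \sum_(z <- Z) size (odd_roots (P z)) +
   (\sum_(z <- Z) (size (sqrt_part (P z))).-1).*2)%N.
  rewrite -muln2 big_distrl -big_split /=; apply: eq_bigr => z _.
  by rewrite muln2 -size_odd_part_decomp // sP.
rewrite big_const_seq count_predT iter_addn_0.
move: hG hD h2; move: (\sum_(z <- Z) _)%N (\sum_(z <- Z) _)%N (size h) (size Z) => a b c d.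
nia.
Qed.

(** The odd roots of [f] and of [f - s] lie in [{0, s}], are disjoint when [s] is nonzero, and have
    cardinalities of the parity of [d]. *)
Lemma odd_roots_classification f d (Z : seq K) :
  size f = d.+1 -> (2 <= d)%N -> uniq Z -> 0 \in Z -> (size Z <= 2)%N ->
  (forall r, odd (mup r (f - f.[r]%:P)) -> f.[r] \in Z -> r \in Z) ->
  exists G : {poly K}, G \is monic /\
   [\/ f = lead_coef f *: G ^+ 2,
       f = lead_coef f *: ('X * G ^+ 2),
       exists s H, [/\ s != 0, H \is monic, f = lead_coef f *: ('X * ('X - s%:P) * G ^+ 2) &
                     f - s%:P = lead_coef f *: H ^+ 2] |
       exists s H, [/\ s != 0, H \is monic, f = lead_coef f *: (('X - s%:P) * G ^+ 2) &
                     f - s%:P = lead_coef f *: ('X * H ^+ 2)]].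
Proof.
move=> sf d2 uZ Z0 sZ closedZ.
have sfz z : size (f - z%:P) = d.+1.
  by rewrite size_polyDl // size_polyN (leq_ltn_trans (size_polyC_leq1 _)) // sf ltnS ltnW.
have lfz z : lead_coef (f - z%:P) = lead_coef f.
  by rewrite lead_coefDl // size_polyN (leq_ltn_trans (size_polyC_leq1 _)) // sf ltnS ltnW.
have f0 z : f - z%:P != 0 by rewrite -size_poly_eq0 sfz.
have oddZ z r : z \in Z -> r \in odd_roots (f - z%:P) -> r \in Z /\ f.[r] = z.
  move=> zZ; rewrite odd_rootsP // => or.
  have : root (f - z%:P) r by apply: contraTT or => /mupNroot ->.
  rewrite /root !hornerE subr_eq0 => /eqP fr; split=> //.
  by apply: closedZ; rewrite fr.
have decf z := odd_part_decomp (f0 z).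
have par z : odd d = odd (size (odd_roots (f - z%:P))).
  by have := size_odd_part_decomp (f0 z); rewrite sfz /= => ->; rewrite oddD odd_double addbF.
(* The case [s = 0] encodes a singleton [Z]. *)
have [s Zs hs] : exists2 s, (s \in Z) & Z =i [:: 0; s].
  case: (Z) uZ Z0 sZ => [|a [|b []]] //=.
    by rewrite !inE => _ /eqP <- _; exists 0; rewrite ?inE // => x; rewrite !inE orbb.
  rewrite !inE => /andP[ab _] /orP[] /eqP <- _; [exists b | exists a]; rewrite ?inE ?eqxx ?orbT //.
  by move=> x; rewrite !inE orbC.
have prodf z : z \in Z -> s != 0 ->
    perm_eq (odd_roots (f - z%:P)) [seq x <- [:: 0; s] | x \in odd_roots (f - z%:P)].
  move=> zZ s0; apply: uniq_perm; first exact: odd_roots_uniq.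
    by apply: filter_uniq; rewrite /= inE eq_sym s0.
  move=> x; rewrite mem_filter; case: (boolP (x \in odd_roots _)) => //= hx.
  by have [] := oddZ _ _ zZ hx; rewrite hs.
have fE : f - 0%:P = f by rewrite polyC0 subr0.
have [s0|s0] := eqVneq s 0.
  have sub r : r \in odd_roots f -> r = 0.
    by rewrite -fE => /(oddZ _ _ Z0)[]; rewrite hs s0 !inE orbb => /eqP ->.
  exists (sqrt_part f); split; first exact: sqrt_part_monic.
  have := decf 0; rewrite fE; have := odd_roots_uniq f.
  case: (odd_roots f) sub => [|a [|b t]] sub /=.
  - by rewrite big_nil mul1r => _; constructor 1.
  - by rewrite big_seq1 (sub a) ?inE // subr0 => _; constructor 2.
  - by rewrite !inE (sub a) ?inE // (sub b) ?inE ?eqxx ?orbT.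
have disj x : x \in odd_roots f -> x \in odd_roots (f - s%:P) -> false.
  rewrite -{1}fE => /(oddZ _ _ Z0)[_ h1] /(oddZ _ _ Zs)[_ h2].
  by move: s0; rewrite -h2 h1 eqxx.
have d0 := decf 0; have ds := decf s; rewrite lfz in ds.
have p0 := prodf 0 Z0 s0; have ps := prodf s Zs s0.
have par0 := par 0; have pars := par s.
rewrite (perm_size ps) /= in pars; rewrite (perm_big _ ps) /= in ds.
rewrite (perm_size p0) /= fE in par0; rewrite (perm_big _ p0) /= fE in d0.
exists (sqrt_part f); split; first exact: sqrt_part_monic.
(* Of the sixteen membership patterns, disjointness and parity leave five: [f] has odd roots none
   (twice), [{0}], [{0, s}] or [{s}]. *)
move: (disj 0) (disj s) par0 pars d0 ds.
case: (0 \in odd_roots f); case: (s \in odd_roots f);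
case: (0 \in odd_roots (f - s%:P)); case: (s \in odd_roots (f - s%:P)) => /= D1 D2 par0 pars;
  try (by have := D1 isT isT); try (by have := D2 isT isT);
  try (by move: par0; rewrite pars); rewrite ?big_cons ?big_nil ?subr0 ?mulr1 ?mul1r => d0 ds;
  first [ by constructor 1 | by constructor 2
        | by constructor 3; exists s, (sqrt_part (f - s%:P)); rewrite sqrt_part_monic
        | by constructor 4; exists s, (sqrt_part (f - s%:P)); rewrite sqrt_part_monic ].
Qed.

End OddMultiplicity.

(** * The Chebyshev-like exceptions *)

Section ChebyshevRecurrence.
Variable K : fieldType.
Hypothesis K2 : (2 : K) != 0.
Implicit Types (f G H U V : {poly K}) (A s : K).

Lemma monic_dvdp_scale n U V c :
  V \is monic -> size V = n.+1 -> (size U <= n.+1)%N -> V %| U -> U`_n = c ->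
  U = c *: V.
Proof.
move=> Vm sV sU dV Un; apply/eqP; rewrite -subr_eq0.
have dW : V %| U - c *: V by rewrite dvdp_sub // -mul_polyC dvdp_mulIr.
apply: contraTT dW => W0; apply/negP => /(dvdp_leq W0); rewrite sV leqNgt => /negP; apply.
rewrite ltnS; apply/leq_sizeP => j; rewrite leq_eqVlt => /orP[/eqP <-|nj].
  have Vn : V`_n = 1 by move/monicP: Vm; rewrite lead_coefE sV.
  by rewrite coefB coefZ Un Vn mulr1 subrr.
rewrite coefB coefZ !nth_default ?mulr0 ?subr0 //; first by rewrite sV.
exact: leq_trans nj.
Qed.

Lemma coprimep_sqr_parts f s G H U V :
  s != 0 -> f = U * G ^+ 2 -> f - s%:P = V * H ^+ 2 -> coprimep G H.
Proof.
move=> s0 fG fH; apply/coprimepP => D DG DH.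
have Df : D %| f by rewrite fG dvdp_mull // (dvdp_trans DG) // dvdp_exp.
have : D %| s%:P.
  have -> : s%:P = f - V * H ^+ 2 by rewrite -fH opprB addrCA subrr addr0.
  by rewrite dvdp_sub // dvdp_mull // (dvdp_trans DH) // dvdp_exp.
have s0P : s%:P != 0 by rewrite polyC_eq0.
move=> Ds; have := dvdp_leq s0P Ds; rewrite size_polyC s0 => h1.
rewrite -size_poly_eq1 eqn_leq h1 size_poly_gt0.
by apply: contraTneq Ds => ->; rewrite dvd0p.
Qed.

Lemma size_sqr_monic G : G \is monic -> size (G ^+ 2) = (size G).-1.*2.+1.
Proof.
move=> Gm; have := size_exp G 2; rewrite muln2 => <-.
by rewrite prednK // size_poly_gt0 expf_neq0 // monic_neq0.
Qed.

Lemma size_sub_const f s : (1 < size f)%N -> size (f - s%:P) = size f.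
Proof.
by move=> f1; rewrite size_polyDl // size_polyN (leq_ltn_trans (size_polyC_leq1 _)).
Qed.

Lemma deriv_sqr f : (f ^+ 2)^`() = 2 *: (f * f^`()).
Proof. by rewrite expr2 derivM scaler_nat; ring. Qed.

Lemma even_chebyshev_deriv f A s G H n :
  A != 0 -> s != 0 -> G \is monic -> H \is monic -> size H = n.+1 ->
  f = A *: ('X * ('X - s%:P) * G ^+ 2) -> f - s%:P = A *: H ^+ 2 ->
  H^`() = n%:R *: G.
Proof.
move=> A0 s0 Gm Hm sH fG fH.
have sf : size f = (size G).-1.*2.+3.
  rewrite fG size_scale // -mulrA size_monicM ?monicX ?mulf_neq0 ?expf_neq0 ?monic_neq0 //.
    rewrite size_monicM ?monicXsubC ?expf_neq0 ?monic_neq0 //.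
    by rewrite size_polyX size_XsubC size_sqr_monic.
  by rewrite monicXsubC.
have G1 : (0 < size G)%N by rewrite size_poly_gt0 monic_neq0.
have sG : size G = n.
  have := size_sub_const s (_ : 1 < size f)%N; rewrite sf => /(_ isT).
  by rewrite fH size_scale // size_sqr_monic // sH /=; move: G1; move: (size G) => g; lia.
have cGH : coprimep G H.
  apply: (@coprimep_sqr_parts f s G H (A *: ('X * ('X - s%:P))) A%:P) => //.
    by rewrite -scalerAl.
  by rewrite mul_polyC.
have df : f^`() = (A * 2) *: (H * H^`()).
  by rewrite -(subrK s%:P f) fH derivD derivC addr0 derivZ deriv_sqr scalerA.
have dG : G %| H^`().
  rewrite -(Gauss_dvdpr _ cGH) -(dvdpZr _ _ (mulf_neq0 A0 K2)) -df.
  by apply: dvdp_sqr_deriv; rewrite fG dvdpZr // dvdp_mulIr.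
have [m nm] : exists m, n = m.+1 by exists n.-1; move: G1; rewrite sG; case: (n).
apply: (@monic_dvdp_scale m _ _ _ Gm _ _ dG); first by rewrite sG nm.
  by rewrite -nm -ltnS -sH lt_size_deriv // monic_neq0.
have Hn : H`_m.+1 = 1 by move/monicP: Hm; rewrite lead_coefE sH nm.
by rewrite coef_deriv Hn nm.
Qed.

Lemma even_chebyshev_recurrence f A s G H n :
  A != 0 -> s != 0 -> G \is monic -> H \is monic -> size H = n.+1 ->
  f = A *: ('X * ('X - s%:P) * G ^+ 2) -> f - s%:P = A *: H ^+ 2 ->
  forall j : nat,
    s * j.+1%:R * (2 * j%:R + 1) * H`_j.+1 = 2 * (j%:R ^+ 2 - n%:R ^+ 2) * H`_j.
Proof.
move=> A0 s0 Gm Hm sH fG fH j.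
have dH := even_chebyshev_deriv A0 s0 Gm Hm sH fG fH.
have ode1 : 'X * ('X - s%:P) * H^`() ^+ 2 = n%:R ^+ 2 *: (H ^+ 2 + (s / A)%:P).
  rewrite dH exprZn -scalerAr; congr (_ *: _); apply: (scalerI A0).
  by rewrite -fG scalerDr -fH -mul_polyC -polyCM mulrCA mulfV // mulr1 subrK.
have ode : (2 * 'X - s%:P) * H^`() + 2 * ('X * ('X - s%:P) * H^`()^`()) =
           (2 * n%:R ^+ 2) *: H.
  (* In positive characteristic [n] may vanish in [K]; then both sides of [ode] are zero. *)
  have [H'0|H'0] := eqVneq H^`() 0.
    have /eqP : n%:R *: G = 0 by rewrite -dH.
    rewrite scaler_eq0 (negPf (monic_neq0 Gm)) orbF => /eqP ->.
    by rewrite H'0 derivC expr0n !mulr0 addr0 scale0r.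
  apply: (mulIf H'0).
  have := congr1 (fun P => P^`()) ode1.
  rewrite derivZ derivD derivC addr0 deriv_sqr scalerA [_ * 2]mulrC scalerAl => <-.
  rewrite !derivM derivX derivB derivX derivC; ring.
have := congr1 (fun P : {poly K} => P`_j) ode.
have XH' i : ('X * H^`())`_i = i%:R * H`_i.
  by rewrite coefXM; case: i => [|i]; rewrite ?mul0r // coef_deriv mulr_natl.
have XH'' i : ('X * H^`()^`())`_i = i%:R * i.+1%:R * H`_i.+1.
  rewrite coefXM; case: i => [|i]; rewrite ?mul0r //.
  by rewrite /= !coef_deriv -mulrA !mulr_natl.
have XXH'' i : ('X * ('X * H^`()^`()))`_i = i%:R * (i%:R - 1) * H`_i.
  rewrite coefXM; case: i => [|i]; rewrite ?mul0r //= XH''.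
  by rewrite -(addn1 i) natrD addrK [i%:R * _]mulrC.
rewrite (_ : _ + _ = 2 *: ('X * H^`()) - s *: H^`() +
   2 *: ('X * ('X * H^`()^`()) - s *: ('X * H^`()^`()))); last first.
  rewrite !scaler_nat -!mul_polyC; ring.
rewrite !(coefD, coefN, coefZ) XH' XXH'' XH'' coef_deriv -mulr_natl => e.
rewrite -(natr1 j) in e *.
move/eqP: e; rewrite -subr_eq0 => /eqP e; apply/eqP.
rewrite -subr_eq0 -oppr_eq0 -[X in _ == X]e; apply/eqP; ring.
Qed.

(** Here [f^]() = A G U[, with]U[the left-hand side;]H[divides]f^[()] and is coprime to [G], so it
    divides [U]. The constant is the coefficient of degree [n] of [U]. *)
Lemma odd_chebyshev_deriv f A s G H n :
  A != 0 -> s != 0 -> G \is monic -> H \is monic -> size G = n.+1 ->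
  f = A *: (('X - s%:P) * G ^+ 2) -> f - s%:P = A *: ('X * H ^+ 2) ->
  G + 2 *: (('X - s%:P) * G^`()) = (2 * n%:R + 1) *: H.
Proof.
move=> A0 s0 Gm Hm sG fG fH.
have sf : size f = n.*2.+2.
  rewrite fG size_scale // size_monicM ?monicXsubC ?expf_neq0 ?monic_neq0 //.
  by rewrite size_XsubC size_sqr_monic // sG.
have H1 : (0 < size H)%N by rewrite size_poly_gt0 monic_neq0.
have sH : size H = n.+1.
  have := size_sub_const s (_ : 1 < size f)%N; rewrite sf => /(_ isT).
  rewrite fH size_scale // size_monicM ?monicX ?expf_neq0 ?monic_neq0 //.
  by rewrite size_polyX size_sqr_monic //=; move: H1; move: (size H) => h; lia.
have cGH : coprimep H G.
  rewrite coprimep_sym.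
  apply: (@coprimep_sqr_parts f s G H (A *: ('X - s%:P)) (A *: 'X)) => //.
    by rewrite -scalerAl.
  by rewrite -scalerAl.
set U := G + _.
have df : f^`() = A *: (G * U).
  rewrite fG derivZ; congr (_ *: _); rewrite expr2 !derivM derivB derivX derivC /U.
  rewrite scaler_nat; ring.
have dU : H %| U.
  rewrite -(Gauss_dvdpr _ cGH) -(dvdpZr _ _ A0) -df.
  have -> : f^`() = (f - s%:P)^`() by rewrite derivB derivC subr0.
  by apply: dvdp_sqr_deriv; rewrite fH dvdpZr // dvdp_mulIr.
apply: (monic_dvdp_scale Hm sH _ dU).
  apply: (leq_trans (size_polyD _ _)); rewrite geq_max sG leqnn /=.
  apply: (leq_trans (size_scale_leq _ _)); apply: (leq_trans (size_polyMleq _ _)).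
  by rewrite size_XsubC /= -sG lt_size_deriv // monic_neq0.
have Gn : G`_n = 1 by move/monicP: Gm; rewrite lead_coefE sG.
rewrite coefD coefZ mulrBl coefB coefXM coefCM !coef_deriv.
rewrite [G`_n.+1]nth_default ?sG // mul0rn mulr0 subr0.
by case: n Gn {sG sf sH} => [|m] Gn; rewrite /= ?coef_deriv Gn ?mulr0 addrC.
Qed.

Lemma odd_chebyshev_recurrence f A s G H n :
  A != 0 -> s != 0 -> G \is monic -> H \is monic -> size G = n.+1 ->
  f = A *: (('X - s%:P) * G ^+ 2) -> f - s%:P = A *: ('X * H ^+ 2) ->
  forall j : nat,
    2 * s * j.+1%:R * (2 * j%:R + 1) * G`_j.+1 =
    ((2 * j%:R + 1) ^+ 2 - (2 * n%:R + 1) ^+ 2) * G`_j.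
Proof.
move=> A0 s0 Gm Hm sG fG fH j.
have := odd_chebyshev_deriv A0 s0 Gm Hm sG fG fH.
set c : K := 2 * n%:R + 1; set U := G + _ => UH.
have ode1 : 'X * U ^+ 2 = c ^+ 2 *: (('X - s%:P) * G ^+ 2 - (s / A)%:P).
  rewrite UH exprZn -scalerAr; congr (_ *: _); apply: (scalerI A0).
  by rewrite -fH scalerBr -fG -[A *: (s / A)%:P]mul_polyC -polyCM mulrCA mulfV // mulr1.
have ode : U + 2 * ('X * U^`()) = (c ^+ 2) *: G.
  have [U0|U0] := eqVneq U 0.
    have /eqP : c *: H = 0 by rewrite -UH.
    rewrite scaler_eq0 (negPf (monic_neq0 Hm)) orbF => /eqP ->.
    by rewrite U0 derivC expr0n !mulr0 addr0 scale0r.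
  apply: (mulIf U0).
  have := congr1 (fun P => P^`()) ode1.
  rewrite derivZ derivB derivC subr0 => h.
  have hU : (('X - s%:P) * G ^+ 2)^`() = G * U.
    rewrite expr2 !derivM derivB derivX derivC /U scaler_nat; ring.
  rewrite -scalerAl -hU -h expr2 !derivM derivX; ring.
have XP (P : {poly K}) i : ('X * P^`())`_i = i%:R * P`_i.
  by rewrite coefXM; case: i => [|i]; rewrite ?mul0r // coef_deriv mulr_natl.
have Uj : U`_j = (2 * j%:R + 1) * G`_j - 2 * s * j.+1%:R * G`_j.+1.
  rewrite /U mulrBl -mul_polyC coefD coefCM coefB XP coefCM coef_deriv.
  rewrite -[G`_j.+1 *+ j.+1]mulr_natl; ring.
have := congr1 (fun P : {poly K} => P`_j) ode.
rewrite coefD coefZ (_ : 2 * ('X * U^`()) = 2 *: ('X * U^`())); last first.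
  by rewrite scaler_nat mulr_natl.
rewrite coefZ XP Uj => e.
move/eqP: e; rewrite -subr_eq0 => /eqP e; apply/eqP.
rewrite -subr_eq0 -oppr_eq0 -[X in _ == X]e; apply/eqP; ring.
Qed.

End ChebyshevRecurrence.

(** * Descent to the finite field *)

Section SquareRootDescent.
Variables (F L : fieldType) (iota : {rmorphism F -> L}).
Hypothesis F2 : (2 : F) != 0.

(** Completing the square: the coefficients of [G] are determined from the top down, each by a
    division by 2. *)
Lemma poly_sqrt_approx (P : {poly F}) n :
  P \is monic -> size P = n.*2.+1 ->
  exists G : {poly F}, [/\ G \is monic, size G = n.+1 & (size (P - G ^+ 2)%R <= n)%N].
Proof.
move=> Pm sP.
suff H m : (m <= n)%N -> exists G : {poly F},
    [/\ G \is monic, size G = n.+1 & (size (P - G ^+ 2)%R <= n + (n - m))%N].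
  by have [G] := H n (leqnn n); rewrite subnn addn0; exists G.
elim: m => [_|m IH mn].
  exists 'X^n; split; rewrite ?monicXn ?size_polyXn // subn0 addnn.
  apply/leq_sizeP => j; rewrite -exprM muln2 coefB coefXn leq_eqVlt => /orP[/eqP <-|nj].
    by move/monicP: Pm; rewrite lead_coefE sP eqxx => ->; rewrite subrr.
  by rewrite nth_default ?sP // gtn_eqF // subrr.
have [G [Gm sG hG]] := IH (ltnW mn).
set j := (n - m.+1)%N; have jn : (j < n)%N by rewrite /j; lia.
have ej : (n - m)%N = j.+1 by rewrite /j; lia.
rewrite ej addnS in hG.
(* The cross term [2 c G X^j] cancels the coefficient of degree [n + j], and [c ^ 2 X^(2 j)] lies
   below it. *)
pose c := (P - G ^+ 2)`_(n + j) / 2.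
have scX : (size (c *: 'X^j) <= j.+1)%N.
  by rewrite (leq_trans (size_scale_leq _ _)) // size_polyXn.
have sG' : size (G + c *: 'X^j) = n.+1.
  by rewrite size_polyDl sG // (leq_ltn_trans scX).
exists (G + c *: 'X^j); split=> //.
  by rewrite monicE lead_coefDl ?sG ?(leq_ltn_trans scX) // -monicE.
apply/leq_sizeP => l hl.
have -> : P - (G + c *: 'X^j) ^+ 2 =
    P - G ^+ 2 - (2 * c) *: (G * 'X^j) - c ^+ 2 *: 'X^(j + j).
  rewrite exprD -!mul_polyC polyCM polyC_exp; ring.
rewrite coefB [X in X - _]coefB !coefZ coefMXn coefXn.
have -> : (l == j + j)%N = false by apply/negbTE/eqP; lia.
rewrite mulr0 subr0 ltnNge (_ : j <= l)%N; last by lia.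
move: hl; rewrite /= leq_eqVlt => /orP[/eqP <-|hl].
  rewrite addnK; have -> : G`_n = 1 by move/monicP: Gm; rewrite lead_coefE sG.
  by rewrite mulr1 /c mulrCA mulfV // mulr1 subrr.
rewrite nth_default; last exact: leq_trans hl.
rewrite nth_default ?mulr0 ?subr0 // sG; lia.
Qed.

(* If [G] approximates the square root of [P] over [F], then
   [(H - G) * (H + G)] has degree less than [n] while [H + G] has degree [n]. *)
Lemma sqrt_descent (P : {poly F}) (H : {poly L}) n :
  P \is monic -> size P = n.*2.+1 -> H \is monic -> size H = n.+1 ->
  (size (map_poly iota P - H ^+ 2)%R <= n)%N -> exists G, H = map_poly iota G.
Proof.
move=> Pm sP Hm sH hP; have [G [Gm sG hG]] := poly_sqrt_approx Pm sP.
exists G; apply/eqP; rewrite -subr_eq0.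
have eqn : (H - map_poly iota G) * (H + map_poly iota G) =
    map_poly iota (P - G ^+ 2) - (map_poly iota P - H ^+ 2).
  rewrite rmorphB rmorphXn /=; ring.
have : (size ((H - map_poly iota G) * (H + map_poly iota G))%R <= n)%N.
  rewrite eqn (leq_trans (size_polyD _ _)) // geq_max size_polyN hP andbT.
  by rewrite size_map_poly.
apply: contraTT => h0; rewrite -ltnNge.
have sum0 : H + map_poly iota G != 0.
  apply/eqP => /polyP/(_ n); rewrite coefD coef_map coef0 /=.
  have -> : G`_n = 1 by move/monicP: Gm; rewrite lead_coefE sG.
  have -> : H`_n = 1 by move/monicP: Hm; rewrite lead_coefE sH.
  rewrite -(rmorph1 iota) -rmorphD => /eqP; rewrite fmorph_eq0; exact/negP.
have : (n < size (H + map_poly iota G)%R)%N.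
  rewrite ltnNge; apply: contra sum0 => /leq_sizeP /(_ n (leqnn n)) /eqP.
  rewrite coefD coef_map /=.
  have -> : G`_n = 1 by move/monicP: Gm; rewrite lead_coefE sG.
  have -> : H`_n = 1 by move/monicP: Hm; rewrite lead_coefE sH.
  by rewrite -(rmorph1 iota) -rmorphD fmorph_eq0 (negPf F2).
rewrite size_mul //; have : (0 < size (H - map_poly iota G)%R)%N by rewrite size_poly_gt0.
move: (size _) (size _) => x y; lia.
Qed.

(** The constant [s] is not assumed to come from [F]: after division by [A] it only perturbs degree
    0, which the approximate descent tolerates once [H] is nonconstant. *)
Lemma scaled_sqrt_descent (P : {poly F}) (H : {poly L}) A (s : L) :
  A != 0 -> H \is monic -> s = 0 \/ (1 < size H)%N ->
  map_poly iota P - s%:P = iota A *: H ^+ 2 -> exists G, H = map_poly iota G.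
Proof.
move=> A0 Hm hs hP.
have iA0 : iota A != 0 by rewrite fmorph_eq0.
have H0 : (0 < size H)%N by rewrite size_poly_gt0 monic_neq0.
have sH2 : size (H ^+ 2) = (size H).-1.*2.+1 by exact: size_sqr_monic.
have sHs : (size (s%:P)%R < size (H ^+ 2)%R)%N \/ s = 0.
  case: hs => [->|h1]; [by right | left].
  by rewrite (leq_ltn_trans (size_polyC_leq1 _)) // sH2; lia.
have P_eq : map_poly iota P = iota A *: H ^+ 2 + s%:P by rewrite -hP subrK.
have sP : size P = (size H).-1.*2.+1.
  rewrite -(size_map_poly iota) P_eq; case: sHs => [h|->].
    by rewrite size_polyDl size_scale.
  by rewrite polyC0 addr0 size_scale.
have lP : lead_coef P = A.
  apply: (fmorph_inj iota); rewrite -lead_coef_map P_eq.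
  have lH2 : lead_coef (iota A *: H ^+ 2) = iota A.
    by rewrite lead_coefZ lead_coef_exp (monicP Hm) expr1n mulr1.
  case: sHs => [h|->]; last by rewrite polyC0 addr0.
  by rewrite lead_coefDl // size_scale.
apply: (@sqrt_descent (A^-1 *: P) H (size H).-1) => //.
- by rewrite monicE lead_coefZ lP mulVf.
- by rewrite size_scale ?invr_eq0.
- by rewrite prednK.
rewrite linearZ /= P_eq scalerDr scalerA fmorphV mulVf // scale1r addrC addKr.
apply: (leq_trans (size_scale_leq _ _)).
case: hs => [->|h]; first by rewrite polyC0 size_poly0.
by rewrite (leq_trans (size_polyC_leq1 _)) // -ltnS prednK.
Qed.

End SquareRootDescent.

(** * Polynomials with zero derivative as Frobenius powers *)

Section FrobeniusPower.
Variables (F : finFieldType) (p k : nat).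
Hypotheses (p_pr : prime p) (k_gt0 : (0 < k)%N) (cardF : #|F| = (p ^ k)%N).

(** Only exponents divisible by [p] survive, and [c ^ (p ^ (k - 1))] is a [p]-th root of [c] in
    [F]. *)
Lemma deriv_eq0_pth_power (f : {poly F}) :
  f^`() = 0 -> exists h : {poly F}, f = h ^+ p.
Proof.
move=> f'0; have pF := card_finPcharP cardF p_pr.
exists (\poly_(i < size f) (f`_(i * p) ^+ (p ^ k.-1))).
have powD : {morph (fun u : {poly F} => u ^+ p) : u v / u + v}.
  by move=> u v; apply: exprDn_pchar; rewrite pnatE // pchar_poly.
have pow0 : (0 : {poly F}) ^+ p = 0 by rewrite expr0n gtn_eqF ?prime_gt0.
rewrite poly_def (big_morph _ powD pow0).
apply/polyP => l; rewrite coef_sum.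
rewrite (eq_bigr (fun i : 'I_(size f) => f`_(i * p) * (l == i * p)%N%:R)) => [|i _]; last first.
  rewrite exprZn -!exprM -expnSr prednK // -cardF expf_card coefZ coefXn.
  by [].
have [/dvdnP[i li]|pl] := boolP (p %| l)%N.
  have [hi|hi] := ltnP i (size f).
    rewrite (bigD1 (Ordinal hi)) //= li eqxx mulr1 big1 ?addr0 // => j ji.
    rewrite eqn_pmul2r ?prime_gt0 // (_ : (i == j)%N = false) ?mulr0 //.
    by apply: contraNF ji => /eqP ij; apply/eqP/val_inj.
  have fl0 : f`_l = 0.
    by rewrite nth_default // li (leq_trans hi) // leq_pmulr // prime_gt0.
  rewrite fl0 big1 // => j _; rewrite li eqn_pmul2r ?prime_gt0 // gtn_eqF ?mulr0 //.
  exact: leq_trans (ltn_ord j) hi.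
rewrite big1 => [|i _]; last first.
  by rewrite (_ : (l == _)%N = false) ?mulr0 //; apply: contraNF pl => /eqP ->; exact: dvdn_mull.
case: l pl => [|l]; first by rewrite dvdn0.
move=> pl; have := congr1 (fun u : {poly F} => u`_l) f'0.
rewrite coef_deriv coef0 -mulr_natr => /eqP.
by rewrite mulf_eq0 -(dvdn_pcharf pF) (negPf pl) orbF => /eqP.
Qed.

Lemma frobenius_power_decomp (f : {poly F}) :
  (1 < size f)%N -> exists (h : {poly F}) e, f = h ^+ (p ^ e) /\ h^`() != 0.
Proof.
have [n] := ubnP (size f); elim: n f => // n IH f fn f1.
have [f'0|f'0] := eqVneq f^`() 0; last by exists f, 0%N; rewrite expn0 expr1.
have [h hp] := deriv_eq0_pth_power f'0.
have sf : (size f).-1 = ((size h).-1 * p)%N by rewrite hp size_exp.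
have p1 := prime_gt1 p_pr.
have h1 : (1 < size h)%N.
  by move: sf f1; case: (size h) => [|[|s]] //=; rewrite mul0n; case: (size f) => [|[|s]].
have hn : (size h < n)%N.
  apply: leq_trans (fn : (size f <= n)%N); move: sf f1 h1 p1; move: (size f) (size h) => a b; nia.
have [h2 [e [h2e h2'0]]] := IH h hn h1.
by exists h2, e.+1; split=> //; rewrite hp h2e -exprM expnSr.
Qed.

End FrobeniusPower.

(** * Square products of iterates force an exceptional form *)

Section ExceptionalForms.
Variables (F : finFieldType) (p k : nat).
Hypotheses (p_pr : prime p) (p_odd : odd p) (k_gt0 : (0 < k)%N).
Hypothesis cardF : #|F| = (p ^ k)%N.
Local Notation iota := (alg_closure_inj F).
Local Notation K := (alg_closure F).
Implicit Types f : {poly F}.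

Lemma two_neq0 (R : nzRingType) : p \in [pchar R] -> (2 : R) != 0.
Proof.
move=> pR; rewrite -(dvdn_pcharf pR) dvdn_prime2 //.
by apply: contraTN p_odd => /eqP ->.
Qed.

Lemma pchar_closure : p \in [pchar K].
Proof. by rewrite (fmorph_pchar iota) (card_finPcharP cardF p_pr). Qed.

Lemma map_poly_iter f n : map_poly iota (poly_iter f n) = comp_iter (map_poly iota f) n.
Proof.
elim: n => [|n IH]; first exact: map_polyX.
rewrite -[poly_iter f n.+1]/(f \Po poly_iter f n) map_comp_poly IH.
by [].
Qed.

Lemma exists_frobenius_root e : exists zt : K -> K, forall z, zt z ^+ (p ^ e) = z.
Proof.
have N0 : (0 < p ^ e)%N by rewrite expn_gt0 prime_gt0.
have H z : exists y : K, y ^+ (p ^ e) == z.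
  have /closed_rootP[y] : size ('X^(p ^ e) - z%:P : {poly K}) != 1%N.
    by rewrite size_XnsubC // eqSS -lt0n.
  by rewrite /root !hornerE subr_eq0; exists y.
by exists (fun z => xchoose (H z)) => z; apply/eqP; exact: (xchooseP (H z)).
Qed.

Lemma frobenius_polyB (u v : {poly K}) e : (u - v) ^+ (p ^ e) = u ^+ (p ^ e) - v ^+ (p ^ e).
Proof.
have D (a b : {poly K}) : (a + b) ^+ (p ^ e) = a ^+ (p ^ e) + b ^+ (p ^ e).
  by apply: exprDn_pchar; rewrite pnatX pnatE // pchar_poly pchar_closure.
by apply/eqP; rewrite eq_sym subr_eq -D subrK.
Qed.

(** Forms (b) and (c) require the square root to descend to [F]. Forms (d) and (e) allow it to stay
    over the closure, and only [s] must descend, to become [B]. *)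
Lemma form_of_classification f d : size f = d.+1 -> (2 <= d)%N ->
  forall Z : seq K, uniq Z -> 0 \in Z -> (size Z <= 2)%N ->
  (forall r, odd (mup r (map_poly iota f - (map_poly iota f).[r]%:P)) ->
     (map_poly iota f).[r] \in Z -> r \in Z) ->
  [\/ form_b f, form_c f, form_d f | form_e f].
Proof.
move=> sf d2 Z uZ Z0 sZ closedZ; set fK := map_poly iota f.
have F2 := two_neq0 (card_finPcharP cardF p_pr).
have K2 := two_neq0 pchar_closure.
have f0 : f != 0 by rewrite -size_poly_eq0 sf.
set A := lead_coef f; have A0 : A != 0 by rewrite lead_coef_eq0.
have iA0 : iota A != 0 by rewrite fmorph_eq0.
have sfK : size fK = d.+1 by rewrite size_map_poly.
have [G [Gm]] := odd_roots_classification sfK d2 uZ Z0 sZ closedZ.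
rewrite lead_coef_map -/A.
case=> [fG|fG|[s [H [s0 Hm fG fH]]]|[s [H [s0 Hm fG fH]]]].
- have [g Gg] : exists g, G = map_poly iota g.
    apply: (@scaled_sqrt_descent _ _ iota F2 f G A 0) => //; first by left.
    by rewrite polyC0 subr0.
  constructor 1; exists A, g; apply: (map_poly_inj iota).
  by rewrite linearZ /= rmorphXn /= -Gg.
- have /factor_theorem[f1 ff1] : root f 0.
    rewrite /root -(fmorph_eq0 iota) -horner_map rmorph0.
    by rewrite -/fK fG hornerZ hornerM hornerX mul0r mulr0.
  rewrite polyC0 subr0 in ff1.
  have f1G : map_poly iota f1 = iota A *: G ^+ 2.
    apply: (@mulIf _ 'X); first by rewrite polyX_eq0.
    by rewrite -scalerAl [G ^+ 2 * 'X]mulrC -fG /fK ff1 rmorphM /= map_polyX.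
  have [g Gg] : exists g, G = map_poly iota g.
    apply: (@scaled_sqrt_descent _ _ iota F2 f1 G A 0) => //; first by left.
    by rewrite polyC0 subr0.
  constructor 2; exists A, g; apply: (map_poly_inj iota).
  by rewrite linearZ /= rmorphM rmorphXn /= map_polyX -Gg.
- have sH0 : (0 < size H)%N by rewrite size_poly_gt0 monic_neq0.
  have sH1 : (1 < size H)%N.
    have fK1 : (1 < size fK)%N by rewrite sfK; exact: ltnW.
    have := size_sub_const s fK1; rewrite sfK fH size_scale // size_sqr_monic //.
    by case: (size H) => [|[|n]] // [de]; move: d2; rewrite -de.
  have [h Hh] : exists h, H = map_poly iota h.
    by apply: (@scaled_sqrt_descent _ _ iota F2 f H A s) => //; right.
  (* Since [H] descends to [h], evaluating [f - s = A H^2] at 0 places [s] in the image of [F]. *)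
  pose B := (f.[0] - A * h.[0] ^+ 2).
  have sB : s = iota B.
    have := congr1 (fun u : {poly K} => u.[0]) fH.
    rewrite hornerD hornerN hornerC hornerZ horner_exp Hh -(rmorph0 iota) !horner_map.
    move=> e; rewrite /B rmorphB rmorphM rmorphXn -e opprB addrC subrK //.
  constructor 3; exists A, B, (size H).-1, (fun i => H`_i).
  rewrite prednK // coefK -sB; split.
  + by rewrite -fH subrK.
  (* At 0 the factored form gives [f(0) = 0], so [H(0)^2 = - s / A]. *)
  + have := congr1 (fun u : {poly K} => u.[0]) fH.
    rewrite fG !(hornerD, hornerN, hornerC, hornerZ, hornerM, hornerX, horner_exp).
    rewrite !mul0r mulr0 add0r => e; rewrite rmorphN fmorph_div -sB.
    apply: (mulfI iA0); have -> : iota A * - (s / iota A) = - s.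
      by rewrite mulrN mulrCA mulfV // mulr1.
    by rewrite -horner_coef0 e.
  + move=> i /andP[i1 _]; case: i i1 => // j _; rewrite subn1 /=.
    have sHn : size H = (size H).-1.+1 by rewrite prednK.
    have e := even_chebyshev_recurrence K2 iA0 s0 Gm Hm sHn fG fH j.
    rewrite -(natr1 j) in e *; move/eqP: e; rewrite -subr_eq0 => /eqP e; apply/eqP.
    rewrite -subr_eq0 -[X in _ == X]e; apply/eqP; ring.
- have sG0 : (0 < size G)%N by rewrite size_poly_gt0 monic_neq0.
  have sB : s = iota f.[0].
    have := congr1 (fun u : {poly K} => u.[0]) fH.
    rewrite -horner_map rmorph0 -/fK.
    rewrite !(hornerD, hornerN, hornerC, hornerZ, hornerM, hornerX) mul0r mulr0.
    by move=> /subr0_eq.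
  constructor 4; exists A, f.[0], (size G).-1, (fun i => G`_i).
  rewrite prednK // coefK -sB; split=> //.
  + have := congr1 (fun u : {poly K} => u.[0]) fG.
    rewrite -{1}(rmorph0 iota) horner_map -sB.
    rewrite !(hornerD, hornerN, hornerC, hornerZ, hornerM, hornerX, horner_exp) add0r => e.
    rewrite rmorphN fmorph_div rmorph1 -horner_coef0.
    apply: (mulfI iA0); have -> : iota A * - (1 / iota A) = - 1.
      by rewrite mulrN mulrCA mulfV // mulr1.
    apply: (mulfI (_ : - s != 0)); first by rewrite oppr_eq0.
    by rewrite mulrCA -e mulrN1 opprK.
  + move=> i /andP[i1 _]; case: i i1 => // j _; rewrite subn1 /=.
    have sGn : size G = (size G).-1.+1 by rewrite prednK.
    have e := odd_chebyshev_recurrence K2 iA0 s0 Gm Hm sGn fG fH j.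
    rewrite -(natr1 j) in e *; move/eqP: e; rewrite -subr_eq0 => /eqP e.
    apply: (mulfI K2); apply/eqP; rewrite -subr_eq0 -[X in _ == X]e; apply/eqP; ring.
Qed.

Lemma iter_prod_not_square f d :
  size f = d.+1 -> (2 <= d)%N ->
  ~ form_a p f -> ~ form_b f -> ~ form_c f -> ~ form_d f -> ~ form_e f ->
  forall m (A : {set 'I_m}), A != set0 -> forall c u, iter_prod f A <> c *: u ^+ 2.
Proof.
move=> sf d2 na nb nc nd ne m A A0 c u hA.
have sfK : size (map_poly iota f) = d.+1 by rewrite size_map_poly.
have [Z [uZ Z0 closedZ]] : exists Z : seq K, [/\ uniq Z, 0 \in Z &
    forall r, odd (mup r (map_poly iota f - (map_poly iota f).[r]%:P)) ->
      (map_poly iota f).[r] \in Z -> r \in Z].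
  apply: (@exists_closed_odd_set _ _ _ A (iota c) (map_poly iota u)) => //.
    by rewrite sfK; exact: ltnW.
  rewrite -rmorphXn -linearZ /= -hA rmorph_prod.
  by apply: eq_bigr => j _; exact: (esym (map_poly_iter f j)).
have [h [e [fh h'0]]] : exists (h : {poly F}) e, f = h ^+ (p ^ e) /\ h^`() != 0.
  by apply: (frobenius_power_decomp p_pr k_gt0 cardF); rewrite sf; exact: ltnW.
have h2 : (2 < size h)%N.
  (* A linear [h] would give form (a), its leading coefficient supplying [A] after the Frobenius
     power; [e >= 1] because [d >= 2]. *)
  rewrite ltnNge; apply/negP => h2.
  have h1 : size h = 2.
    apply/eqP; rewrite eqn_leq h2 ltnNge; apply: contra h'0 => /size1_polyC ->.
    by rewrite derivC.
  have l0 : lead_coef h != 0 by rewrite lead_coef_eq0 -size_poly_eq0 h1.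
  apply: na; exists (lead_coef h ^+ (p ^ e)), (- (h`_0 / lead_coef h)), e; split.
    rewrite lt0n; apply/eqP => e0; move: sf d2; rewrite fh e0 expn0 expr1 h1.
    by case=> <-.
  rewrite fh -exprZn; congr (_ ^+ _).
  rewrite polyCN opprK scalerDr -[_ *: (_)%:P]mul_polyC -polyCM mulrCA mulfV // mulr1.
  have lh : lead_coef h = h`_1 by rewrite lead_coefE h1.
  apply/polyP => -[|[|i]]; rewrite coefD coefZ coefX coefC /= ?mulr0 ?mulr1 ?add0r ?addr0 //.
  by rewrite nth_default // h1.
have [zt hzt] := exists_frobenius_root e.
have sZ : (size Z <= 2)%N.
  apply: (@size_closed_odd_set _ (map_poly iota f) (map_poly iota h) zt (p ^ e)) => //.
  - by rewrite oddX p_odd orbT.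
  - by move=> z; rewrite frobenius_polyB fh rmorphXn -polyC_exp hzt.
  - by rewrite deriv_map map_poly_eq0.
  - by rewrite size_map_poly.
by have [] := form_of_classification sf d2 uZ Z0 sZ closedZ.
Qed.

End ExceptionalForms.

(** * The bound on runs *)

Lemma exists_isqrt n : exists w, (w ^ 2 <= n)%N /\ (n < w.+1 ^ 2)%N.
Proof.
elim: n => [|n [w [h1 h2]]]; first by exists 0%N.
have [h|h] := ltnP n.+1 (w.+1 ^ 2); first by exists w; split; rewrite // (leq_trans h1).
by exists w.+1; split=> //; move: h2 h; lia.
Qed.

(* The exponent [m] balances [q / 2 ^ m] against [d ^ m * sqrt q]. *)
Lemma run_length_nat (F : finFieldType) p k (f : {poly F}) a d n (b : bool) :
  prime p -> odd p -> (0 < k)%N -> #|F| = (p ^ k)%N -> size f = d.+1 -> (2 <= d)%N ->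
  ~ form_a p f -> ~ form_b f -> ~ form_c f -> ~ form_d f -> ~ form_e f ->
  consecutive_run (fun x => is_square x (+) b) f a n ->
  exists m, (n * 2 ^ m <= 65 * #|F|)%N /\ (#|F| <= (2 * d) ^ (2 * m.+1))%N.
Proof.
move=> p_pr p_odd k0 cF sf d2 na nb nc nd ne hrun.
have [w [wq qw]] := exists_isqrt #|F|.
have w0 : (0 < w)%N.
  rewrite lt0n; apply: contraTneq qw => ->; rewrite -leqNgt; exact: ltnW (finRing_gt1 F).
have d1 : (1 < 2 * d)%N by lia.
pose m := trunc_log (2 * d) w; exists m.
have /andP[hm hm1] : ((2 * d) ^ m <= w < (2 * d) ^ m.+1)%N by exact: trunc_log_bounds.
have := run_bound p_pr p_odd cF sf d2
  (iter_prod_not_square p_pr p_odd k0 cF sf d2 na nb nc nd ne (m := m)) wq qw hrun.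
move: wq qw hm hm1 => wq qw; rewrite [((2 * d) ^ m)%N]expnMn => hm hm1 hb.
have h1 : (2 ^ m * d ^ m * w <= w ^ 2)%N by rewrite -mulnn leq_mul2r hm orbT.
(* This pays for replacing [n - m] by [n]. The total is [2 q + 62 q + q = 65 q]. *)
have h2 : (m * 2 ^ m <= w)%N.
  apply: leq_trans hm; rewrite mulnC leq_mul2l; apply/orP; right.
  apply: (@leq_trans (2 ^ m)); first exact: ltnW (ltn_expl _ _).
  by case: (m) => // m'; rewrite leq_exp2r.
have ww : (w <= w ^ 2)%N by rewrite -mulnn leq_pmulr.
split.
  have := leq_add hb h2; rewrite -mulnDl => h3.
  have nm : (n * 2 ^ m <= (n - m + m) * 2 ^ m)%N by rewrite leq_mul2r addnC -leq_subLR leqnn orbT.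
  apply: (leq_trans nm); move: h3 h1 ww wq.
  have -> : (2 ^ m * (31 * d ^ m * w) = 31 * (2 ^ m * d ^ m * w))%N by lia.
  move: (2 ^ m * d ^ m * w)%N (w ^ 2)%N (#|F|) ((_ + _) * _)%N => x y z t; lia.
rewrite [(2 * m.+1)%N]mulnC expnM; apply: (leq_trans (ltnW qw)).
by rewrite leq_exp2r.
Qed.

Theorem theorem1p3 (R : realType) (d : nat) (hd : (2 <= d)%N) :
  exists C : R,
    forall (p k : nat) (F : finFieldType) (f : {poly F}) (a : F),
      prime p -> odd p -> (1 <= k)%N -> #|F| = (p ^ k)%N ->
      size f = d.+1 ->
      ~ form_a p f -> ~ form_b f -> ~ form_c f -> ~ form_d f -> ~ form_e f ->
      forall n : nat,
        consecutive_run (fun x => is_square x) f a n \/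
        consecutive_run (fun x => ~~ is_square x) f a n ->
        n%:R <= C * ((p ^ k)%N%:R : R) `^
                      ((2 * log2 (d%:R : R) + 1) / (2 * log2 (d%:R : R) + 2)).
Proof.
(* The constant is twice 65, because [q] to the power [1 - th] is bounded by [2 ^ (m + 1)] while the
   run bound carries [2 ^ m]. *)
exists 130 => p k F f a p_pr p_odd k0 cF sf na nb nc nd ne n hrun.
have [b hb] : exists b, consecutive_run (fun x => is_square x (+) b) f a n.
  case: hrun => -[i [us hs]]; [exists false | exists true]; exists i; split=> //;
    by apply: sub_all hs => x; rewrite ?addbF ?addbT.
have [m []] := run_length_nat p_pr p_odd k0 cF sf hd na nb nc nd ne hb.
rewrite cF => hn hq; set q : R := (p ^ k)%N%:R.
have q0 : 0 < q by rewrite ltr0n expn_gt0 prime_gt0.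
have d0 : 0 < d%:R :> R by rewrite ltr0n ltnW.
have ln2 : 0 < ln (2 : R) by rewrite ln_gt0 // ltr1n.
have lnd : 0 < ln (d%:R : R) by rewrite ln_gt0 // ltr1n.
set th := _ / _.
(* That is, [1 - th = 1 / (2 log2 (2 d))], matching [q <= (2 d) ^ (2 (m + 1))]. *)
have hth : (1 - th) * (2 * (ln d%:R + ln 2)) = ln (2 : R).
  rewrite /th /log2; field; apply/andP; split; rewrite gt_eqF //.
  by rewrite addr_gt0 // mulr_gt0.
have hlq : (1 - th) * ln q <= m.+1%:R * ln 2.
  have th1 : 0 <= 1 - th.
    rewrite -(pmulr_lge0 _ (_ : 0 < 2 * (ln d%:R + ln (2 : R)))) ?hth ?ltW //.
    by rewrite mulr_gt0 // addr_gt0.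
  have -> : m.+1%:R * ln (2 : R) = (1 - th) * (m.+1%:R * (2 * (ln d%:R + ln 2))).
    by rewrite mulrCA hth.
  apply: ler_wpM2l => //.
  have : ln q <= ln (((2 * d) ^ (2 * m.+1))%N%:R : R).
    by rewrite ler_ln ?ler_nat // posrE // ltr0n expn_gt0 muln_gt0 /= (ltnW hd).
  rewrite natrX lnXn ?natrM ?mulr_gt0 // lnM ?posrE // -[_ *+ (2 * m.+1)]mulr_natl natrM.
  by rewrite [ln 2 + _]addrC mulrA [_ * 2]mulrC.
have hpow : q <= q `^ th * 2 ^+ m.+1.
  have e1 : q = q `^ (th + (1 - th)) by rewrite addrC subrK powRr1 // ltW.
  rewrite {1}e1 powRD; last by rewrite (gt_eqF q0) implybT.
  apply: ler_wpM2l; first exact: powR_ge0.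
  have e2 := expRM_natl m.+1 (ln (2 : R)); rewrite lnK ?posrE // in e2.
  by rewrite -e2 /powR gt_eqF // ler_expR.
have hn' : n%:R * 2 ^+ m <= 65 * q.
  by rewrite /q -natrX -!natrM ler_nat.
have m2 : 0 < 2 ^+ m :> R by rewrite exprn_gt0.
rewrite -(ler_pM2r m2); apply: (le_trans hn').
move: hpow; rewrite exprS; move: (q `^ th) (2 ^+ m) => x y h; lra.
Qed.
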